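(* Let $\Bbbk$ be a field of characteristic zero, and let $\mathfrak{M}$ be the variety of all non-associative $\Bbbk$-algebras satisfying the identity $$x(x^2)^2=(x^2)^2x.$$ Then the variety $\mathfrak{M}$ is Nielsen--Schreier (every subalgebra of every free $\mathfrak{M}$-algebra is a free $\mathfrak{M}$-algebra), and $\mathfrak{M}$ does not have the Poincaré--Birkhoff--Witt property for universal multiplicative enveloping algebras.
   Context: A non-associative $\Bbbk$-algebra is a $\Bbbk$-vector space with a bilinear product, not assumed associative or unital; $x^2:=xx$. The variety $\mathfrak{M}$ is viewed as a category with all algebra homomorphisms between its members as morphisms. The free $\mathfrak{M}$-algebra on a set $Z$ (not assumed finite) is the quotient of the free non-unital non-associative algebra on $Z$ by the ideal of consequences of the identity; an $\mathfrak{M}$-algebra is free if it is isomorphic to the free $\mathfrak{M}$-algebra on some set. Universal multiplicative enveloping algebra. For an $\mathfrak{M}$-algebra $A$, an $A$-bimodule (in $\mathfrak{M}$) is a vector space $V$ with bilinear maps $A\times V\to V$ and $V\times A\to V$ such that the split null extension $A\oplus V$, with product $(a+v)(b+w)=ab+(aw+vb)$ (so that $V\cdot V=0$), belongs to $\mathfrak{M}$. The universal multiplicative enveloping algebra $U_{\mathfrak{M}}(A)$ is the unital associative algebra generated by symbols $l_a,r_a$ ($a\in A$), linear in $a$, subject to exactly those relations which must hold for the operators $l_a\colon v\mapsto av$, $r_a\colon v\mapsto va$ in all $A$-bimodules; thus left $U_{\mathfrak{M}}(A)$-modules are the same as $A$-bimodules. The assignment $A\mapsto U_{\mathfrak{M}}(A)$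 is functorial: a homomorphism $\varphi\colon A\to B$ induces $l_a\mapsto l_{\varphi(a)}$, $r_a\mapsto r_{\varphi(a)}$. Poincaré--Birkhoff--Witt property. The variety $\mathfrak{M}$ has the PBW property for universal multiplicative enveloping algebras if there is an endofunctor $\mathcal{X}$ of the category of $\Bbbk$-vector spaces (a Schur functor) and an isomorphism of vector spaces $U_{\mathfrak{M}}(A)\cong \mathcal{X}(A)$, where $\mathcal{X}$ is applied to the underlying vector space of $A$, that is natural with respect to all homomorphisms of $\mathfrak{M}$-algebras. *)

(* Defs.v *)
From HB Require Import structures.
From mathcomp Require Import all_boot all_algebra.
From mathcomp Require Import finmap.
From mathcomp.multinomials Require Import monalg.
From mathcomp Require Import boolp.

Set Implicit Arguments.
Unset Strict Implicit.
Unset Printing Implicit Defensive.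

Import GRing.Theory.

Local Open Scope ring_scope.
Local Open Scope quotient_scope.

(* Sets and vector spaces are read classically: a [choiceType] stands for an  *)
(* arbitrary set and a boolean predicate for an arbitrary subset.             *)

Record subspace (k : fieldType) (V : lmodType k) := Subspace {
  subspace_pred :> {pred V};
  subspaceP : submod_closed subspace_pred
}.

HB.instance Definition _ (k : fieldType) (V : lmodType k) (S : subspace V) :=
  GRing.isSubmodClosed.Build k V (subspace_pred S) (subspaceP S).

Section QuotientSpace.
Variables (k : fieldType) (V : lmodType k) (I : subspace V).

Definition quot_space : Type := Quotient.quot (subspace_pred I).
HB.instance Definition _ := Choice.on quot_space.
HB.instance Definition _ := GRing.Zmodule.on quot_space.
HB.instance Definition _ := EqQuotient.on quot_space.

Definition quot_proj (x : V) : quot_space := \pi x.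

Lemma quot_projP x y : reflect (quot_proj x = quot_proj y) (x - y \in I).
Proof. by rewrite Quotient.idealrBE; apply: eqP. Qed.

Lemma quot_projK (u : quot_space) : quot_proj (repr u) = u.
Proof. exact: reprK. Qed.

Lemma quot_projD : {morph quot_proj : x y / x + y}.
Proof. by move=> x y; exact: Quotient.pi_add. Qed.

Definition quot_scale (c : k) (u : quot_space) := quot_proj (c *: repr u).

Lemma quot_scaleE c x : quot_scale c (quot_proj x) = quot_proj (c *: x).
Proof.
apply/quot_projP; rewrite -scalerBr rpredZ //.
by apply/quot_projP; rewrite quot_projK.
Qed.

Lemma quot_scaleA a b u : quot_scale a (quot_scale b u) = quot_scale (a * b) u.
Proof. by rewrite -(quot_projK u) !quot_scaleE scalerA. Qed.

Lemma quot_scale1 : left_id 1 quot_scale.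
Proof. by move=> u; rewrite -(quot_projK u) quot_scaleE scale1r. Qed.

Lemma quot_scaleDr : right_distributive quot_scale +%R.
Proof.
move=> c u v; rewrite -(quot_projK u) -(quot_projK v).
by rewrite -quot_projD !quot_scaleE scalerDr quot_projD.
Qed.

Lemma quot_scaleDl u : {morph quot_scale^~ u : a b / a + b}.
Proof.
by move=> a b; rewrite -(quot_projK u) !quot_scaleE scalerDl quot_projD.
Qed.

HB.instance Definition _ := GRing.Zmodule_isLmodule.Build k quot_space
  quot_scaleA quot_scale1 quot_scaleDr quot_scaleDl.

Lemma quot_proj_is_linear : linear quot_proj.
Proof. by move=> c x y; rewrite quot_projD -quot_scaleE. Qed.
HB.instance Definition _ :=
  GRing.isLinear.Build k V quot_space *:%R quot_proj quot_proj_is_linear.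

End QuotientSpace.

Section LinearExtension.
Variables (k : fieldType) (K : choiceType).

(* the linear extension to the space with basis K of a map on K *)
Definition lin_ext (V : lmodType k) (h : K -> V) (g : {malg k[K]}) : V :=
  \sum_(m <- msupp g) g@_m *: h m.

Lemma lin_extEw (V : lmodType k) (h : K -> V) (g : {malg k[K]}) (d : {fset K}) :
  (msupp g `<=` d)%fset -> lin_ext h g = \sum_(m <- d) g@_m *: h m.
Proof.
move=> le; rewrite /lin_ext (big_fset_incl _ le) => //= x xd.
by move=> /mcoeff_outdom ->; rewrite scale0r.
Qed.

Lemma lin_ext_is_linear (V : lmodType k) (h : K -> V) : linear (lin_ext h).
Proof.
move=> c x y; set d := (msupp x `|` msupp y)%fset.
have le : (msupp (c *: x + y) `<=` d)%fset.
  apply: (fsubset_trans (msuppD_le _ _)); apply: fsetSU; exact: msuppZ_le.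
rewrite (lin_extEw _ le) (@lin_extEw _ _ x d) ?fsubsetUl //.
rewrite (@lin_extEw _ _ y d) ?fsubsetUr // scaler_sumr -big_split /=.
by apply: eq_bigr => m _; rewrite mcoeffD mcoeffZ scalerDl scalerA.
Qed.
HB.instance Definition _ (V : lmodType k) (h : K -> V) :=
  GRing.isLinear.Build k {malg k[K]} V *:%R (lin_ext h) (lin_ext_is_linear h).

Lemma lin_extU (V : lmodType k) (h : K -> V) m : lin_ext h << m >> = h m.
Proof.
by rewrite (lin_extEw _ msuppU_le) big_seq_fset1 mcoeffUU scale1r.
Qed.

Lemma lin_ext_fun (V : lmodType k) (h h1 h2 : K -> V) c (g : {malg k[K]}) :
    (forall m, h m = c *: h1 m + h2 m) ->
  lin_ext h g = c *: lin_ext h1 g + lin_ext h2 g.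
Proof.
move=> hE; rewrite /lin_ext scaler_sumr -big_split; apply: eq_bigr => m _ /=.
by rewrite hE scalerDr !scalerA mulrC.
Qed.

Lemma malg_ind (P : {malg k[K]} -> Prop) :
    P 0 -> (forall m, P << m >>) ->
    (forall c x y, P x -> P y -> P (c *: x + y)) ->
  forall x, P x.
Proof.
move=> P0 PU PD x; rewrite [x]monalgE; elim/big_rec: _ => // m y _ Py.
have ->: << x@_m *g m >> = x@_m *: (<< m >> : {malg k[K]}).
  by apply/malgP => m'; rewrite mcoeffZ !mcoeffU mulrnAr mulr1.
exact: PD.
Qed.

End LinearExtension.

Section MonoidAlgebra.
Variables (k : fieldType) (K : monomType).
Implicit Types s t : {malg k[K]}.

Lemma malgUM (m m' : K) :
  << m >> * << m' >> = << mmul m m' >> :> {malg k[K]}.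
Proof. by rewrite malgM_def fgmulUU mulr1. Qed.

Lemma malgC_comm (c : k) s : c%:MP * s = s * c%:MP.
Proof.
rewrite mul_malgC malgZ_def malgM_def fgmulgU.
by apply: eq_bigr => m _; rewrite mulm1 mulrC.
Qed.

Lemma malg_scalerAr (c : k) s t : c *: (s * t) = s * (c *: t).
Proof. by rewrite -!(mul_malgC c) mulrA malgC_comm mulrA. Qed.

Lemma malgDl (c : k) s s' t : (c *: s + s') * t = c *: (s * t) + s' * t.
Proof. by rewrite mulrDl scalerAl. Qed.

Lemma malgDr (c : k) s t t' : s * (c *: t + t') = c *: (s * t) + s * t'.
Proof. by rewrite mulrDr malg_scalerAr. Qed.

End MonoidAlgebra.

Record nalg (k : fieldType) := NAlg {
  nalg_sort :> lmodType k;
  nalg_mul : nalg_sort -> nalg_sort -> nalg_sort;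
  nalg_mul_linearl : forall y, linear (nalg_mul^~ y);
  nalg_mul_linearr : forall x, linear (nalg_mul x)
}.

Notation "x ∙ y" := (nalg_mul x y) (at level 40, left associativity).

Record nalg_hom (k : fieldType) (A B : nalg k) := NAlgHom {
  nalg_hom_fun :> {linear A -> B};
  nalg_homM : {morph nalg_hom_fun : x y / x ∙ y}
}.

Definition nalg_isomorphic (k : fieldType) (A B : nalg k) : Prop :=
  exists f : nalg_hom A B, bijective f.

Definition in_M (k : fieldType) (A : nalg k) : Prop :=
  forall x : A, x ∙ ((x ∙ x) ∙ (x ∙ x)) = ((x ∙ x) ∙ (x ∙ x)) ∙ x.

Record M_alg (k : fieldType) := MAlg {
  M_nalg :> nalg k;
  M_algP : in_M M_nalg
}.

Record nideal (k : fieldType) (A : nalg k) := NIdeal {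
  nideal_subspace :> subspace A;
  nideall : forall x y : A, y \in nideal_subspace -> x ∙ y \in nideal_subspace;
  nidealr : forall x y : A, x \in nideal_subspace -> x ∙ y \in nideal_subspace
}.

Section QuotientNAlg.
Variables (k : fieldType) (A : nalg k) (I : nideal A).

Definition quot_nmul (u v : quot_space I) := quot_proj I (repr u ∙ repr v).

Lemma quot_nmulE x y :
  quot_nmul (quot_proj I x) (quot_proj I y) = quot_proj I (x ∙ y).
Proof.
have reprB z : repr (quot_proj I z) - z \in I.
  by apply/quot_projP; rewrite quot_projK.
rewrite /quot_nmul; set x' := repr _; set y' := repr _.
apply/quot_projP; rewrite -[_ - _](addrNK (x ∙ y')).
have -> : x' ∙ y' - x ∙ y - x ∙ y' = (x' - x) ∙ y' - x ∙ y.
  by rewrite addrAC -!scaleN1r [x' + _]addrC nalg_mul_linearl [_ + x' ∙ _]addrC.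
rewrite addrAC -addrA rpredD ?nidealr ?reprB //.
have -> : x ∙ y' - x ∙ y = x ∙ (y' - y).
  by rewrite addrC [y' - _]addrC -!scaleN1r nalg_mul_linearr.
by rewrite nideall ?reprB.
Qed.

Lemma quot_nmul_linearl v : linear (quot_nmul^~ v).
Proof.
move=> c u w; rewrite -(quot_projK u) -(quot_projK w) -(quot_projK v).
by rewrite -linearP !quot_nmulE nalg_mul_linearl linearP.
Qed.

Lemma quot_nmul_linearr v : linear (quot_nmul v).
Proof.
move=> c u w; rewrite -(quot_projK u) -(quot_projK w) -(quot_projK v).
by rewrite -linearP !quot_nmulE nalg_mul_linearr linearP.
Qed.

Definition quot_nalg : nalg k := NAlg quot_nmul_linearl quot_nmul_linearr.

Lemma in_M_quot :
    (forall x : A, x ∙ ((x ∙ x) ∙ (x ∙ x)) - ((x ∙ x) ∙ (x ∙ x)) ∙ x \in I) ->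
  in_M quot_nalg.
Proof.
move=> xI u; have [x ->] : exists x, u = quot_proj I x.
  by exists (repr u); rewrite quot_projK.
have M y z : nalg_mul (n := quot_nalg) (quot_proj I y) (quot_proj I z)
             = quot_proj I (y ∙ z) by exact: quot_nmulE.
by rewrite (M x x) (M (x ∙ x)) (M x) (M _ x); apply/quot_projP.
Qed.

End QuotientNAlg.

Inductive magma (Z : Type) : Type :=
  | Gen of Z
  | Mul of magma Z & magma Z.

Section MagmaChoice.
Variable Z : choiceType.

Fixpoint magma_encode (t : magma Z) : GenTree.tree Z :=
  match t with
  | Gen z => GenTree.Leaf z
  | Mul a b => GenTree.Node 0 [:: magma_encode a; magma_encode b]
  end.

Fixpoint magma_decode (t : GenTree.tree Z) : option (magma Z) :=
  match t with
  | GenTree.Leaf z => Some (Gen z)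
  | GenTree.Node _ [:: a; b] =>
      if (magma_decode a, magma_decode b) is (Some a', Some b')
      then Some (Mul a' b') else None
  | _ => None
  end.

Lemma magma_encodeK : pcancel magma_encode magma_decode.
Proof. by elim=> //= a -> b ->. Qed.

HB.instance Definition _ := Choice.copy (magma Z) (pcan_type magma_encodeK).

End MagmaChoice.

Section FreeAlgebras.
Variables (k : fieldType) (Z : choiceType).

Definition free_mul (x y : {malg k[magma Z]}) : {malg k[magma Z]} :=
  lin_ext (fun a => lin_ext (fun b => << Mul a b >>) y) x.

Lemma free_mul_linearl y : linear (free_mul^~ y).
Proof. exact: lin_ext_is_linear. Qed.

Lemma free_mul_linearr x : linear (free_mul x).
Proof.
by move=> c y z; apply: lin_ext_fun => a; exact: lin_ext_is_linear.
Qed.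

Definition free_nalg : nalg k := NAlg free_mul_linearl free_mul_linearr.

(* the smallest ideal that contains all values of the identity *)
Inductive consequence : free_nalg -> Prop :=
  | consequence_identity (x : free_nalg) :
      consequence (x ∙ ((x ∙ x) ∙ (x ∙ x)) - ((x ∙ x) ∙ (x ∙ x)) ∙ x)
  | consequence_linear (c : k) (x y : free_nalg) :
      consequence x -> consequence y -> consequence (c *: x + y)
  | consequence_mull (x y : free_nalg) : consequence y -> consequence (x ∙ y)
  | consequence_mulr (x y : free_nalg) : consequence x -> consequence (x ∙ y).

Lemma consequence0 : consequence 0.
Proof.
pose t := consequence_identity 0.
by move: (consequence_linear (-1) t t); rewrite scaleN1r addNr.
Qed.

Definition consequence_pred : {pred free_nalg} := fun x => `[< consequence x >].

Lemma consequence_submod_closed : submod_closed consequence_pred.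
Proof.
split=> [|c x y /asboolP cx /asboolP cy]; apply/asboolP.
  exact: consequence0.
exact: consequence_linear.
Qed.

Definition consequence_subspace := Subspace consequence_submod_closed.

Lemma consequence_ideall (x y : free_nalg) :
  y \in consequence_subspace -> x ∙ y \in consequence_subspace.
Proof. by move=> /asboolP cy; apply/asboolP/consequence_mull. Qed.

Lemma consequence_idealr (x y : free_nalg) :
  x \in consequence_subspace -> x ∙ y \in consequence_subspace.
Proof. by move=> /asboolP cx; apply/asboolP/consequence_mulr. Qed.

Definition consequence_ideal : nideal free_nalg :=
  NIdeal consequence_ideall consequence_idealr.

Definition free_M_nalg : nalg k := quot_nalg consequence_ideal.

Lemma free_M_nalgP : in_M free_M_nalg.
Proof.
by apply: in_M_quot => x; apply/asboolP/consequence_identity.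
Qed.

Definition free_M : M_alg k := MAlg free_M_nalgP.

End FreeAlgebras.

Definition is_free (k : fieldType) (A : nalg k) : Prop :=
  exists Z : choiceType, nalg_isomorphic A (free_M k Z).

Record subalgebra (k : fieldType) (A : nalg k) := Subalgebra {
  subalgebra_subspace :> subspace A;
  subalgebraM : {in subalgebra_subspace &,
                  forall x y : A, x ∙ y \in subalgebra_subspace}
}.

Section SubalgebraNAlg.
Variables (k : fieldType) (A : nalg k) (S : subalgebra A).

Definition sub_space : Type := {x : A | x \in subspace_pred S}.
HB.instance Definition _ := SubChoice.on sub_space.
HB.instance Definition _ := [SubChoice_isSubLmodule of sub_space by <:].

Definition sub_mul (u v : sub_space) : sub_space :=
  exist _ (val u ∙ val v) (subalgebraM (valP u) (valP v)).

Lemma sub_mul_linearl v : linear (sub_mul^~ v).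
Proof.
move=> c u w; apply: val_inj; exact: nalg_mul_linearl.
Qed.

Lemma sub_mul_linearr v : linear (sub_mul v).
Proof.
move=> c u w; apply: val_inj; exact: nalg_mul_linearr.
Qed.

Definition subalgebra_nalg : nalg k := NAlg sub_mul_linearl sub_mul_linearr.

End SubalgebraNAlg.

Definition Nielsen_Schreier (k : fieldType) : Prop :=
  forall A : M_alg k, is_free A ->
  forall S : subalgebra A, is_free (subalgebra_nalg S).

Section SplitNullExtension.
Variables (k : fieldType) (A : nalg k) (V : lmodType k).
Variables (lact : A -> V -> V) (ract : V -> A -> V).
Hypotheses (lact_linearl : forall v, linear (lact^~ v))
           (lact_linearr : forall a, linear (lact a))
           (ract_linearl : forall a, linear (ract^~ a))
           (ract_linearr : forall v, linear (ract v)).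

Definition null_ext_mul (x y : (A * V)%type) : (A * V)%type :=
  (x.1 ∙ y.1, lact x.1 y.2 + ract x.2 y.1).

Lemma null_ext_mul_linearl y : linear (null_ext_mul^~ y).
Proof.
move=> c x z; congr (_, _) => /=; first exact: nalg_mul_linearl.
by rewrite lact_linearl ract_linearl scalerDr addrACA.
Qed.

Lemma null_ext_mul_linearr y : linear (null_ext_mul y).
Proof.
move=> c x z; congr (_, _) => /=; first exact: nalg_mul_linearr.
by rewrite lact_linearr ract_linearr scalerDr addrACA.
Qed.

Definition split_null_ext : nalg k :=
  NAlg null_ext_mul_linearl null_ext_mul_linearr.

End SplitNullExtension.

Record bimodule (k : fieldType) (A : M_alg k) := Bimodule {
  bimod_sort :> lmodType k;
  lact : A -> bimod_sort -> bimod_sort;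
  ract : bimod_sort -> A -> bimod_sort;
  lact_linearl : forall v, linear (lact^~ v);
  lact_linearr : forall a, linear (lact a);
  ract_linearl : forall a, linear (ract^~ a);
  ract_linearr : forall v, linear (ract v);
  bimodP : in_M (split_null_ext lact_linearl lact_linearr
                                ract_linearl ract_linearr)
}.

Section ZeroBimodule.
Variables (k : fieldType) (A : M_alg k) (V : lmodType k).

Definition zero_lact (a : A) (v : V) : V := 0.
Definition zero_ract (v : V) (a : A) : V := 0.

Lemma zero_lact_linearl v : linear (zero_lact^~ v).
Proof. by move=> c x y; rewrite /zero_lact scaler0 addr0. Qed.
Lemma zero_lact_linearr a : linear (zero_lact a).
Proof. by move=> c x y; rewrite /zero_lact scaler0 addr0. Qed.
Lemma zero_ract_linearl a : linear (zero_ract^~ a).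
Proof. by move=> c x y; rewrite /zero_ract scaler0 addr0. Qed.
Lemma zero_ract_linearr v : linear (zero_ract v).
Proof. by move=> c x y; rewrite /zero_ract scaler0 addr0. Qed.

Lemma zero_in_M : in_M (split_null_ext zero_lact_linearl zero_lact_linearr
                                       zero_ract_linearl zero_ract_linearr).
Proof. by move=> [a v]; congr (_, _); exact: M_algP. Qed.

Definition zero_bimodule : bimodule A := Bimodule zero_in_M.

End ZeroBimodule.

Section Operators.
Variables (k : fieldType) (A : M_alg k).

(* The letters [inl a] and [inr a] stand for the symbols l_a and r_a. *)
Local Notation op_word := {fmonom (A + A)%type}.
Local Notation op_alg := {malg k[{fmonom (A + A)%type}]}.

Section Action.
Variable V : bimodule A.

Definition act_letter (s : A + A) (v : V) : V :=
  match s with inl a => lact a v | inr a => ract v a end.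

Definition act_word (w : op_word) (v : V) : V :=
  foldr act_letter v (fmonom_val w).

Definition act (t : op_alg) (v : V) : V := lin_ext (act_word^~ v) t.

Lemma act_linearl v : linear (act^~ v).
Proof. exact: lin_ext_is_linear. Qed.

Lemma act_letter_linear s : linear (act_letter s).
Proof. case: s => a; [exact: lact_linearr | exact: ract_linearl]. Qed.

Lemma act_word_linear w : linear (act_word w).
Proof.
rewrite /act_word => c u v; elim: (fmonom_val w) => //= s m ->.
exact: act_letter_linear.
Qed.

Lemma act_linearr t : linear (act t).
Proof.
move=> c u v; rewrite /act /lin_ext scaler_sumr -big_split.
by apply: eq_bigr => m _ /=; rewrite act_word_linear scalerDr !scalerA mulrC.
Qed.

Lemma act0l v : act 0 v = 0.
Proof. by rewrite /act linear0. Qed.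

Lemma act0r t : act t 0 = 0.
Proof. by rewrite -[X in act t X](subrr 0) -scaleN1r addrC act_linearr scaleN1r addNr. Qed.

Lemma actU w v : act << w >> v = act_word w v.
Proof. exact: lin_extU. Qed.

Lemma act1 v : act 1 v = v.
Proof. by rewrite actU /act_word fm1. Qed.

Lemma actM s t v : act (s * t) v = act s (act t v).
Proof.
elim/malg_ind: s => [|w|c s1 s2 IH1 IH2].
- by rewrite mul0r !act0l.
- elim/malg_ind: t => [|w'|c t1 t2 IH1 IH2].
  + by rewrite mulr0 act0l act0r.
  + by rewrite malgUM !actU /act_word fmM foldr_cat.
  + rewrite malgDr (act_linearl v c _ _) (act_linearl v c t1 t2).
    rewrite act_linearr; exact: (congr2 (fun a b => c *: a + b) IH1 IH2).
- rewrite malgDl (act_linearl v c _ _) (act_linearl _ c s1 s2).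
  exact: (congr2 (fun a b => c *: a + b) IH1 IH2).
Qed.

End Action.

(* [act] is the action of the free associative algebra on the symbols; the    *)
(* relations are exactly those satisfied by it on all bimodules.              *)
Definition op_relation : {pred op_alg} :=
  fun t => `[< forall (V : bimodule A) (v : V), act t v = 0 >].

Lemma op_relation_submod_closed : submod_closed op_relation.
Proof.
split=> [|c s t /asboolP rs /asboolP rt]; apply/asboolP => V v.
  exact: act0l.
by rewrite act_linearl rs rt scaler0 addr0.
Qed.

Definition op_relations := Subspace op_relation_submod_closed.

Lemma op_relationl (s t : op_alg) : t \in op_relations -> s * t \in op_relations.
Proof. by move=> /asboolP rt; apply/asboolP => V v; rewrite actM rt act0r. Qed.

Lemma op_relationr (s t : op_alg) : s \in op_relations -> s * t \in op_relations.
Proof. by move=> /asboolP rs; apply/asboolP => V v; rewrite actM rs. Qed.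

Definition env : Type := quot_space op_relations.
HB.instance Definition _ := GRing.Lmodule.on env.

Definition env_proj : {linear op_alg -> env} := quot_proj op_relations.

Lemma env_projP (s t : op_alg) :
  env_proj s = env_proj t <-> forall (V : bimodule A) v, act s v = act t v :> V.
Proof.
have actB V v : act (s - t) v = act s v - act t v :> bimod_sort V.
  by rewrite [s - t]addrC [RHS]addrC -!scaleN1r; exact: act_linearl.
split=> [/quot_projP /asboolP st V v | st].
  by apply/eqP; rewrite -subr_eq0 -actB st.
by apply/quot_projP/asboolP => V v; rewrite actB st subrr.
Qed.

Lemma env_projK (u : env) : env_proj (repr u) = u.
Proof. exact: quot_projK. Qed.

Lemma act_repr (V : bimodule A) (t : op_alg) (v : V) :
  act (repr (env_proj t)) v = act t v.
Proof. by apply: (env_projP _ _).1; exact: env_projK. Qed.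

Definition env_one : env := env_proj 1.
Definition env_mul (u v : env) : env := env_proj (repr u * repr v).

Lemma env_mulE s t : env_mul (env_proj s) (env_proj t) = env_proj (s * t).
Proof.
apply/env_projP => V v; rewrite [LHS]actM [RHS]actM act_repr.
by congr act; exact: act_repr.
Qed.

Lemma env_mulA : associative env_mul.
Proof.
move=> u v w; rewrite -(env_projK u) -(env_projK v) -(env_projK w).
by rewrite !env_mulE mulrA.
Qed.

Lemma env_mul1l : left_id env_one env_mul.
Proof. by move=> u; rewrite -(env_projK u) env_mulE mul1r. Qed.

Lemma env_mul1r : right_id env_one env_mul.
Proof. by move=> u; rewrite -(env_projK u) env_mulE mulr1. Qed.

Lemma env_mulDl : left_distributive env_mul +%R.
Proof.
move=> u v w; rewrite -(env_projK u) -(env_projK v) -(env_projK w).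
by rewrite -linearD !env_mulE mulrDl linearD.
Qed.

Lemma env_mulDr : right_distributive env_mul +%R.
Proof.
move=> u v w; rewrite -(env_projK u) -(env_projK v) -(env_projK w).
by rewrite -linearD !env_mulE mulrDr linearD.
Qed.

Lemma env_one_neq0 : env_one != 0.
Proof.
rewrite /env_one -[0](linear0 env_proj); apply/eqP => /env_projP.
move=> /(_ (zero_bimodule A k^o) 1); rewrite act1 act0l => /eqP.
by rewrite (negPf (oner_neq0 _)).
Qed.

HB.instance Definition _ := GRing.Zmodule_isNzRing.Build env
  env_mulA env_mul1l env_mul1r env_mulDl env_mulDr env_one_neq0.

Lemma env_projM : {morph env_proj : s t / s * t}.
Proof. by move=> s t; exact: esym (env_mulE s t). Qed.

Lemma env_projZ c : {morph env_proj : t / c *: t}.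
Proof. exact: linearZ. Qed.

Lemma env_scalerAl (c : k) (u v : env) : c *: (u * v) = c *: u * v.
Proof.
rewrite -(env_projK u) -(env_projK v) -env_projM -!env_projZ -env_projM.
by rewrite scalerAl.
Qed.
HB.instance Definition _ := GRing.Lmodule_isLalgebra.Build k env env_scalerAl.

Lemma env_scalerAr (c : k) (u v : env) : c *: (u * v) = u * (c *: v).
Proof.
rewrite -(env_projK u) -(env_projK v) -env_projM -!env_projZ -env_projM.
by rewrite malg_scalerAr.
Qed.
HB.instance Definition _ := GRing.Lalgebra_isAlgebra.Build k env env_scalerAr.

Definition env_l (a : A) : env := env_proj << fmu (inl a) >>.
Definition env_r (a : A) : env := env_proj << fmu (inr a) >>.

End Operators.

Section Restriction.
Variables (k : fieldType) (A B : M_alg k) (f : nalg_hom A B).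

Section RestrictedBimodule.
Variable V : bimodule B.

Definition res_lact (a : A) (v : V) : V := lact (f a) v.
Definition res_ract (v : V) (a : A) : V := ract v (f a).

Lemma res_lact_linearl v : linear (res_lact^~ v).
Proof. by move=> c a b; rewrite /res_lact linearP lact_linearl. Qed.
Lemma res_lact_linearr a : linear (res_lact a).
Proof. exact: lact_linearr. Qed.
Lemma res_ract_linearl a : linear (res_ract^~ a).
Proof. exact: ract_linearl. Qed.
Lemma res_ract_linearr v : linear (res_ract v).
Proof. by move=> c a b; rewrite /res_ract linearP ract_linearr. Qed.

Lemma res_in_M : in_M (split_null_ext res_lact_linearl res_lact_linearr
                                      res_ract_linearl res_ract_linearr).
Proof.
set E := split_null_ext _ _ _ _; pose E' := split_null_ext
  (@lact_linearl _ _ V) (@lact_linearr _ _ V)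
  (@ract_linearl _ _ V) (@ract_linearr _ _ V).
pose g (x : E) : E' := (f x.1, x.2).
have gM (x y : E) : g (x ∙ y) = g x ∙ g y by congr (_, _); exact: nalg_homM.
have g_eq (x y : E) : x.1 = y.1 -> g x = g y -> x = y.
  by case: x y => [a v] [b w] /= -> [->].
move=> x; apply: g_eq; first exact: M_algP.
by rewrite !gM; exact: bimodP.
Qed.

Definition res_bimodule : bimodule A := Bimodule res_in_M.

End RestrictedBimodule.

Definition map_letter (s : A + A) : (B + B)%type :=
  match s with inl a => inl (f a) | inr a => inr (f a) end.

Local Notation op_word A := {fmonom (A + A)%type}.
Local Notation op_alg A := {malg k[{fmonom (A + A)%type}]}.

Definition map_word (w : op_word A) : op_word B :=
  FMonom (map map_letter (fmonom_val w)).

Definition op_map (t : op_alg A) : op_alg B :=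
  lin_ext (fun w => << map_word w >> : op_alg B) t.

Lemma op_map_linear : linear op_map.
Proof. exact: lin_ext_is_linear. Qed.

Lemma op_map0 : op_map 0 = 0.
Proof. exact: linear0. Qed.

Lemma op_mapU w : op_map << w >> = << map_word w >>.
Proof. exact: lin_extU. Qed.

Lemma act_op_map (V : bimodule B) (t : op_alg A) (v : V) :
  act (op_map t) v = @act k A (res_bimodule V) t v.
Proof.
elim/malg_ind: t => [|w|c s t IHs IHt].
- by rewrite op_map0 !act0l.
- rewrite op_mapU !actU /act_word /=.
  by elim: (fmonom_val w) => //= - [a|a] m ->.
- rewrite op_map_linear (act_linearl v c (op_map s)).
  rewrite (@act_linearl _ _ (res_bimodule V)).
  exact: (congr2 (fun a b => c *: a + b) IHs IHt).
Qed.

Definition env_map (u : env A) : env B := env_proj B (op_map (repr u)).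

Lemma env_mapE t : env_map (env_proj A t) = env_proj B (op_map t).
Proof.
apply/env_projP => V v; rewrite [LHS]act_op_map [RHS]act_op_map.
exact: (@act_repr k A (res_bimodule V)).
Qed.

Lemma env_map_is_linear : linear env_map.
Proof.
move=> c u v; rewrite -(env_projK u) -(env_projK v) -linearP !env_mapE.
by rewrite op_map_linear linearP.
Qed.
HB.instance Definition _ :=
  GRing.isLinear.Build k (env A) (env B) *:%R env_map env_map_is_linear.

Lemma op_map_is_monoid_morphism : monoid_morphism op_map.
Proof.
split=> [|s t].
  by rewrite op_mapU; congr << _ >>; apply/eqP; rewrite fmP /= !fm1.
elim/malg_ind: s => [|w|c s1 s2 IH1 IH2].
- by rewrite mul0r op_map0 mul0r.
- elim/malg_ind: t => [|w'|c t1 t2 IH1 IH2].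
  + by rewrite mulr0 op_map0 mulr0.
  + rewrite malgUM !op_mapU malgUM.
    by congr << _ >>; apply/eqP; rewrite fmP /= !fmM map_cat.
  + rewrite malgDr (op_map_linear c _ (_ * t2)) (op_map_linear c t1) malgDr.
    exact: (congr2 (fun a b => c *: a + b) IH1 IH2).
- rewrite malgDl (op_map_linear c _ (s2 * t)) (op_map_linear c s1) malgDl.
  exact: (congr2 (fun a b => c *: a + b) IH1 IH2).
Qed.

Lemma env_map_is_monoid_morphism : monoid_morphism env_map.
Proof.
split=> [|u v]; first by rewrite env_mapE op_map_is_monoid_morphism.1.
rewrite -(env_projK u) -(env_projK v).
by rewrite -env_projM !env_mapE -env_projM op_map_is_monoid_morphism.2.
Qed.
HB.instance Definition _ := GRing.isMonoidMorphism.Build (env A) (env B) env_map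
  env_map_is_monoid_morphism.

Lemma env_map_l a : env_map (env_l a) = env_l (f a).
Proof.
rewrite env_mapE op_mapU; congr (env_proj B << _ >>).
by apply/eqP; rewrite fmP /= !fmU.
Qed.

Lemma env_map_r a : env_map (env_r a) = env_r (f a).
Proof.
rewrite env_mapE op_mapU; congr (env_proj B << _ >>).
by apply/eqP; rewrite fmP /= !fmU.
Qed.

End Restriction.

Lemma env_l_linear (k : fieldType) (A : M_alg k) : linear (@env_l k A).
Proof.
move=> c a b; rewrite -env_projZ -linearD; apply/env_projP => V v.
by rewrite act_linearl !actU /act_word !fmU /= lact_linearl.
Qed.

Lemma env_r_linear (k : fieldType) (A : M_alg k) : linear (@env_r k A).
Proof.
move=> c a b; rewrite -env_projZ -linearD; apply/env_projP => V v.
by rewrite act_linearl !actU /act_word !fmU /= ract_linearr.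
Qed.

Record vect_functor (k : fieldType) := VectFunctor {
  vfun_obj :> lmodType k -> lmodType k;
  vfun_map : forall V W : lmodType k,
    {linear V -> W} -> {linear vfun_obj V -> vfun_obj W};
  vfun_id : forall V : lmodType k, vfun_map (idfun : {linear V -> V}) =1 id;
  vfun_comp : forall (U V W : lmodType k)
    (f : {linear V -> W}) (g : {linear U -> V}),
    vfun_map (f \o g : {linear U -> W}) =1 vfun_map f \o vfun_map g
}.

(* The functor X is not required to be a Schur functor: evaluating at the     *)
(* algebras with zero product shows that it is isomorphic to                  *)
(* V |-> env (V with zero product), so it is determined by the variety.       *)
Definition PBW_property (k : fieldType) : Prop :=
  exists (X : vect_functor k) (eta : forall A : M_alg k, {linear env A -> X A}),
    (forall A : M_alg k, bijective (eta A)) /\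
    (forall (A B : M_alg k) (f : nalg_hom A B) (u : env A),
      eta B (env_map f u) = vfun_map X f (eta A u)).

(* Main.v *)
Require Import Defs.
From mathcomp Require Import all_boot all_algebra.
From HB Require Import structures.
From mathcomp Require Import finmap.
From mathcomp.multinomials Require Import monalg.
From mathcomp Require Import perm ring zify.
From mathcomp Require Import boolp wochoice.

Set Implicit Arguments.
Unset Strict Implicit.
Unset Printing Implicit Defensive.

Import GRing.Theory.

Local Open Scope ring_scope.

(* Write g x = (x x)(x x), so that the identity reads x (g x) = (g x) x.      *)
(*                                                                            *)
(* Nielsen-Schreier. In a free algebra F the kernel of the multiplication map *)
(* F (x) F -> F is spanned by the tensors x (x) g x - g x (x) x; dually, a    *)
(* bilinear form beta with beta x (g x) = beta (g x) x ("balanced") is        *)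
(* beta x y = l (x y) for some linear l. The heart of the matter is that this *)
(* persists for a subalgebra S of F: every relation sum a_i b_i = 0 with      *)
(* a_i, b_i in S is a combination of the tensors above with x in S. Take a    *)
(* basis of F that is adapted to the degree filtration and to S, and write    *)
(* sum a_i (x) b_i as the image of a symmetric 5-tensor t. If t involves      *)
(* elements outside S in its top degree, let c be one of least degree: the    *)
(* coefficient of c in the first factor is g applied to the derivative of t   *)
(* along c, because the quadruple products that could contribute c consist of *)
(* elements of degree less than deg c, hence lie in S. Since g is injective   *)
(* on symmetric 4-tensors, this is a contradiction. A complement W of S S in  *)
(* S, chosen along the filtration, then generates S; the kernel of the map    *)
(* from the free algebra on W lies in every power of the augmentation ideal,  *)
(* hence is zero.                                                             *)
(*                                                                            *)
(* PBW. Bimodules are described by d_x s_(x x) s_x = d_(g x) with d = l - r   *)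
(* and s = l + r. In the algebra with basis x, y and x x = y (other products  *)
(* zero) the component of degree (2, 2) of this relation is d_y s_y s_y = 0,  *)
(* whereas d_y s_y s_y <> 0 over the subalgebra k y, on which the product is  *)
(* zero. So the map of enveloping algebras is not injective, although a       *)
(* functor of vector spaces preserves split monomorphisms.                    *)

(** * Polarisation of five-linear maps *)

(** Nielsen-Schreier rests on a duality. A balanced bilinear form on a free algebra factors through
    the product ([balanced_form]); dually, every vanishing sum of products is accounted for by the
    tensors of the identity. [balanced_vanish] transfers this to a subalgebra S and to forms that
    are balanced on S only. A symmetric 5-tensor that accounts for a relation between elements of S
    has no component outside S above the degree bound ([top_support]), because a symmetric 4-tensor
    can be recovered from its image under g by linear functionals ([quad_functional]).
    Characteristic zero enters through polarisation ([polarization], [sum_sym_eq0]), which exchanges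
    the identity for symmetric tensors, and through the invertibility of small integers.

    Everything is stated relative to a degree bound m, and two instances are used. For forms with
    values in a quotient of the ambient algebra, it shows that a sum of products of S of degree at
    most m can be rewritten with factors of total degree at most m ([prodS_sum]); hence the chosen
    generators W are linearly independent modulo S S ([W_independent]). For m = 0 and forms with
    values in the free algebra on W modulo a power of its augmentation ideal, it pushes the kernel
    of the map to S into the next power ([theta_inj]); these powers meet in zero ([fge_residual]).

    For PBW, naturality would make [env_map] injective along every homomorphism that has a linear
    retraction. The inclusion [line_incl_hom] has one, yet [plane_relation] makes [env_map] kill an
    element that is non-zero on [line_bimodule]. *)

Definition tup5 (D : Type) (a b c d e : D) : {ffun 'I_5 -> D} :=
  [ffun i : 'I_5 => nth a [:: a; b; c; d; e] i].

Definition i0 : 'I_5 := @Ordinal 5 0 isT.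
Definition i1 : 'I_5 := @Ordinal 5 1 isT.
Definition i2 : 'I_5 := @Ordinal 5 2 isT.
Definition i3 : 'I_5 := @Ordinal 5 3 isT.
Definition i4 : 'I_5 := @Ordinal 5 4 isT.

Lemma tup5K (D : Type) (h : {ffun 'I_5 -> D}) :
  tup5 (h i0) (h i1) (h i2) (h i3) (h i4) = h.
Proof.
apply/ffunP => i; rewrite ffunE.
by case: i => [[|[|[|[|[|//]]]]] Hi] /=; congr (h _); apply: val_inj.
Qed.

Lemma sum_tup5 (k : fieldType) (X : lmodType k) (D : finType)
    (F : {ffun 'I_5 -> D} -> X) :
  \sum_h F h = \sum_a \sum_b \sum_c \sum_d \sum_e F (tup5 a b c d e).
Proof.
pose t (p : D * (D * (D * (D * D)))) :=
  tup5 p.1 p.2.1 p.2.2.1 p.2.2.2.1 p.2.2.2.2.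
have tK : bijective t.
  exists (fun h : {ffun 'I_5 -> D} => (h i0, (h i1, (h i2, (h i3, h i4))))).
    by case=> a [b [c [d e]]]; rewrite /t /tup5 !ffunE.
  exact: tup5K.
rewrite (reindex t); last exact: onW_bij.
rewrite -[LHS](pair_bigA _ (fun a p => F (t (a, p)))); apply: eq_bigr => a _ /=.
rewrite -[LHS](pair_bigA _ (fun b p => F (t (a, (b, p))))).
apply: eq_bigr => b _ /=.
rewrite -[LHS](pair_bigA _ (fun c p => F (t (a, (b, (c, p)))))).
apply: eq_bigr => c _ /=.
by rewrite -[LHS](pair_bigA _ (fun d e => F (t (a, (b, (c, (d, e))))))).
Qed.

Section FiveLinear.
Variables (k : fieldType) (V X : lmodType k).
Implicit Types P : V -> V -> V -> V -> V -> X.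

Definition linear5 P : Prop :=
  [/\ forall b c d e, linear (fun a => P a b c d e),
      forall a c d e, linear (fun b => P a b c d e),
      forall a b d e, linear (fun c => P a b c d e),
      forall a b c e, linear (fun d => P a b c d e) &
      forall a b c d, linear (fun e => P a b c d e)].

Definition app5 P (x : 'I_5 -> V) := P (x i0) (x i1) (x i2) (x i3) (x i4).

Lemma linear_sum_scale (D : finType) (f : V -> X) (c : D -> k) (b : D -> V) :
  linear f -> f (\sum_i c i *: b i) = \sum_i c i *: f (b i).
Proof.
move=> flin; elim/big_rec2: _ => [|i y x _ <-]; last by rewrite flin.
by have := flin (-1) 0 0; rewrite !scaleN1r oppr0 addr0 addNr.
Qed.

Lemma app5_expand P (D : finType) (c : D -> k) (b : D -> V) (y : V) :
    linear5 P -> y = \sum_i c i *: b i ->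
  P y y y y y =
  \sum_(h : {ffun 'I_5 -> D}) (\prod_i c (h i)) *: app5 P (b \o h).
Proof.
move=> [l0 l1 l2 l3 l4] ->; rewrite sum_tup5.
rewrite (linear_sum_scale _ _ (l0 _ _ _ _)); apply: eq_bigr => i _.
rewrite (linear_sum_scale _ _ (l1 _ _ _ _)) scaler_sumr; apply: eq_bigr => j _.
rewrite (linear_sum_scale _ _ (l2 _ _ _ _)) !scaler_sumr.
apply: eq_bigr => l _.
rewrite (linear_sum_scale _ _ (l3 _ _ _ _)) !scaler_sumr.
apply: eq_bigr => m _.
rewrite (linear_sum_scale _ _ (l4 _ _ _ _)) !scaler_sumr.
apply: eq_bigr => n _.
rewrite !scalerA /app5 /= !ffunE /=; congr (_ *: _).
by rewrite !big_ord_recl big_ord0 !ffunE /= mulr1 !mulrA.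
Qed.

(* Inclusion-exclusion over the sums of the subfamilies of [x]. *)
Lemma polarization P (x : 'I_5 -> V) :
    linear5 P -> (forall y, P y y y y y = 0) ->
  \sum_(s : {ffun 'I_5 -> 'I_5} | injectiveb s) app5 P (x \o s) = 0.
Proof.
move=> Plin P0.
pose n (s : {ffun 'I_5 -> 'I_5}) j := #|[pred i | s i == j]|.
pose sg (u : {ffun 'I_5 -> bool}) : k := \prod_j (-1) ^+ u j.
(* The signed sum over subfamilies factors over j. As 0 ^+ 0 = 1, the factor of j vanishes when s
   misses j; for bijective s every factor is -1, so only these s survive, with the common
   coefficient (-1) ^+ 5. *)
have E (s : {ffun 'I_5 -> 'I_5}) :
    \sum_u sg u * (\prod_i (u (s i))%:R) = \prod_j (0 ^+ n s j - 1).
  transitivity (\prod_j \sum_(b : bool) ((-1) ^+ b * b%:R ^+ n s j) : k).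
    rewrite bigA_distr_bigA; apply: eq_bigr => u _; rewrite big_split /=.
    congr (_ * _).
    rewrite (partition_big s predT) //=; apply: eq_bigr => j _.
    rewrite (eq_bigr (fun=> (u j)%:R)); last by move=> i /eqP ->.
    by rewrite prodr_const.
  apply: eq_bigr => j _; rewrite big_bool /= expr1n mulr1 expr1 expr0 mul1r.
  by rewrite addrC.
have S : \sum_u sg u *: \sum_(s : {ffun 'I_5 -> 'I_5})
           (\prod_i (u (s i))%:R) *: app5 P (x \o s) = 0.
  apply: big1 => u _.
  by rewrite -(app5_expand (c := fun i => (u i)%:R) Plin erefl) P0 scaler0.
move: S; under eq_bigr do rewrite scaler_sumr.
rewrite exchange_big /=.
under eq_bigr => s _ do
  (under eq_bigr do rewrite scalerA; rewrite -scaler_suml E).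
rewrite (bigID (fun s : {ffun 'I_5 -> 'I_5} => injectiveb s)) /=.
rewrite [X in _ + X]big1 ?addr0; last first.
  move=> s /negP sni.
  have /forallPn [j jP] : ~~ [forall j, [exists i, s i == j]].
    apply/negP => /forallP sj; apply: sni.
    have sS : codom s =i predT.
      by move=> j; have /existsP [i /eqP <-] := sj j; rewrite codom_f.
    by apply/card_uniqP; rewrite (eq_card sS) size_codom.
  suff nj0 : n s j = 0%N.
    by rewrite (bigD1 j) //= nj0 expr0 subrr mul0r scale0r.
  apply/eqP; rewrite -leqn0 leqNgt; apply: contra jP => /card_gt0P [i ij].
  by apply/existsP; exists i.
rewrite (eq_bigr (fun s : {ffun 'I_5 -> 'I_5} => (- 1) *: app5 P (x \o s))).
  move/eqP; rewrite -scaler_sumr scaler_eq0 oppr_eq0 oner_eq0 /=.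
  by move/eqP.
move=> s /injectiveP sI; congr (_ *: _).
rewrite (eq_bigr (fun=> - 1)) ?prodr_const ?card_ord.
  by rewrite -signr_odd /= expr1.
move=> j _; have [t _ tK] := injF_bij sI.
suff -> : n s j = 1%N by rewrite expr1 sub0r.
apply: etrans (card1 (t j)); apply: eq_card => i.
by rewrite !inE -{1}(tK j) (inj_eq sI).
Qed.

(** In characteristic zero a symmetric tensor is a combination of fifth powers, on which [P]
    vanishes. Concretely, the sum is unchanged when the positions are permuted; adding up all
    permutations gives polarised sums, which are zero, and the number of permutations is
    invertible. *)
Lemma sum_sym_eq0 P (D : finType) (T : {ffun 'I_5 -> D} -> k) (b : D -> V) :
    [pchar k] =i pred0 -> linear5 P -> (forall y, P y y y y y = 0) ->
    (forall (h : {ffun 'I_5 -> D}) (s : 'I_5 -> 'I_5), injective s ->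
       T [ffun i => h (s i)] = T h) ->
  \sum_h T h *: app5 P (b \o h) = 0.
Proof.
move=> char0 Plin P0 Tsym; set S := LHS.
have SE (s : 'I_5 -> 'I_5) : injective s ->
    S = \sum_h T h *: app5 P ((b \o h) \o s).
  move=> sI; rewrite /S (reindex (fun h : {ffun 'I_5 -> D} => [ffun i => h (s i)])).
    apply: eq_bigr => h _; rewrite Tsym //; congr (_ *: _).
    by rewrite /app5 /= !ffunE.
  apply: onW_bij; have [t sK tK] := injF_bij sI.
  exists (fun h : {ffun 'I_5 -> D} => [ffun i => h (t i)]) => h;
    by apply/ffunP => i; rewrite !ffunE ?tK ?sK.
have : \sum_(s : {ffun 'I_5 -> 'I_5} | injectiveb s) S = 0.
  rewrite (eq_bigr (fun s : {ffun 'I_5 -> 'I_5} =>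
    \sum_h T h *: app5 P ((b \o h) \o s))); last by move=> s /injectiveP /SE.
  rewrite exchange_big; apply: big1 => h _.
  by rewrite -scaler_sumr polarization // scaler0.
rewrite sumr_const -scaler_nat => /eqP; rewrite scaler_eq0 => /orP[|/eqP //].
rewrite ((pcharf0P k).1 char0) => /eqP /card0_eq /(_ [ffun i => i]).
rewrite unfold_in => /negbT /negP[].
by apply/injectiveP => i j; rewrite !ffunE.
Qed.

End FiveLinear.

(** * Bases adapted to a rank function *)

Lemma well_order_total_trans (T : eqType) (R : rel T) :
  well_order R -> [/\ total R, antisymmetric R & transitive R].
Proof.
move=> Rwo; have RwoT : wo_chain R predT by move=> A _; exact: Rwo.
have tot x y : R x y || R y x by exact: (wo_chainW RwoT).
have anti x y : R x y && R y x -> x = y.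
  by apply: (wo_chain_antisymmetric RwoT).
split=> // y x z Rxy Ryz.
have ne : nonempty [mem [:: x; y; z]] by exists x; exact: mem_head.
have [w [[wA lbw] _]] := Rwo _ ne.
have lb u : u \in [:: x; y; z] -> R w u by exact: lbw.
have {wA} : w \in [:: x; y; z] by [].
rewrite !inE => /or3P[] /eqP e; rewrite e in lb.
- by apply: lb; rewrite !inE eqxx !orbT.
- have -> // : x = y by apply: anti; rewrite Rxy lb ?mem_head.
- have <- // : y = z by apply: anti; rewrite Ryz lb // !inE eqxx orbT.
Qed.

(** Lexicographic order: rank first, ties broken by an arbitrary well-order. *)
Lemma ranked_well_order (T : choiceType) (rk : T -> nat) :
  exists le : rel T,
    [/\ total le, antisymmetric le, transitive le,
        forall x y, le x y -> (rk x <= rk y)%N &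
        forall Q : T -> Prop, (exists x, Q x) ->
          exists x, Q x /\ forall y, Q y -> le x y].
Proof.
have [R Rwo] := well_ordering_principle T.
have [tot anti trans] := well_order_total_trans Rwo.
exists (fun x y => (rk x < rk y)%N || ((rk x == rk y) && R x y)); split.
- by move=> x y; case: ltngtP => //= _; exact: tot.
- move=> x y; case: ltngtP => //= _; exact: anti.
- move=> y x z; case: (ltngtP (rk x)) => //= [xy _ /orP[yz|/andP[/eqP <- _]]|-> Rxy].
  + by rewrite (ltn_trans xy).
  + by rewrite xy.
  + by case: ltngtP => //= _; exact: trans.
- by move=> x y; case: ltngtP.
- move=> Q [x Qx].
  have nQ : exists n, `[< exists2 y, Q y & rk y = n >].
    by exists (rk x); apply/asboolP; exists x.
  case: (ex_minnP nQ) => n /asboolP [z Qz zn] nmin.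
  have [] := Rwo (fun y => `[< Q y /\ rk y = n >]).
    by exists z; rewrite unfold_in; apply/asboolP.
  move=> w [[/asboolP [Qw wn] lbw] _]; exists w; split=> // y Qy.
  have := nmin (rk y); rewrite wn => ny.
  have {ny} : (n <= rk y)%N by apply: ny; apply/asboolP; exists y.
  rewrite leq_eqVlt => /orP[/eqP ny|->//].
  by rewrite -ny eqxx ltnn /= lbw // unfold_in; apply/asboolP.
Qed.

Section AdaptedBasis.
Variables (k : fieldType) (V : lmodType k).

Inductive lspan (Q : V -> Prop) : V -> Prop :=
  | lspan0 : lspan Q 0
  | lspan_cons c x y : Q x -> lspan Q y -> lspan Q (c *: x + y).

Lemma lspan_lin Q c x y : lspan Q x -> lspan Q y -> lspan Q (c *: x + y).
Proof.
elim=> [|d u v Qu _ IH] Qy; first by rewrite scaler0 add0r.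
by rewrite scalerDr scalerA -addrA; apply: lspan_cons; auto.
Qed.

Lemma lspan_gen (Q : V -> Prop) x : Q x -> lspan Q x.
Proof. by move=> Qx; rewrite -[x]scale1r -[_ *: x]addr0; apply: lspan_cons (lspan0 _). Qed.

Lemma lspan_trans (Q Q' : V -> Prop) x :
  (forall y, Q y -> lspan Q' y) -> lspan Q x -> lspan Q' x.
Proof.
by move=> QQ'; elim=> [|c u v Qu _ IH]; [exact: lspan0 | apply: lspan_lin; auto].
Qed.

Lemma lspan_lin_ext (K : choiceType) (b : K -> V) (g : {malg k[K]})
    (Q : V -> Prop) :
  (forall e, e \in msupp g -> Q (b e)) -> lspan Q (lin_ext b g).
Proof.
rewrite /lin_ext => gQ; rewrite big_seq.
elim/big_rec: _ => [|e x eg Qx]; first exact: lspan0.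
by apply: lspan_cons => //; exact: gQ.
Qed.

(** Greedy choice along a well-order refining [rk]: keep the vectors outside the span of the
    strictly smaller ones. A relation would put its largest member in the span of smaller ones, and
    a minimal counterexample shows that each x is spanned by basis vectors up to x, hence of rank at
    most [rk x]. *)
Lemma adapted_basis (rk : V -> nat) :
  exists E : {pred V},
    injective (lin_ext (fun e : {x : V | x \in E} => val e)
               : {malg k[{x : V | x \in E}]} -> V) /\
    forall x, exists g : {malg k[{x : V | x \in E}]},
      lin_ext (fun e => val e) g = x /\
      forall e, e \in msupp g -> (rk (val e) <= rk x)%N.
Proof.
have [le [tot anti trans le_rk le_min]] := ranked_well_order rk.
pose lt x y := le x y && (x != y).
pose E : {pred V} := fun x => `[< ~ lspan (lt^~ x) x >].
have sE x : lspan (fun e => e \in E /\ le e x) x.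
  apply: contrapT => nx.
  have [|z [nz zmin]] := le_min (fun x => ~ lspan (fun e => e \in E /\ le e x) x).
    by exists x.
  apply: nz.
  have [zE|] := boolP (z \in E).
    by apply: lspan_gen; split=> //; rewrite -[le z z]orbb tot.
  rewrite unfold_in => /asboolPn /contrapT sz.
  apply: lspan_trans sz => y /andP[yz yNz].
  have sy : lspan (fun e => e \in E /\ le e y) y.
    apply: contrapT => /zmin zy; move/negP: yNz; apply.
    by apply/eqP/anti; rewrite yz.
  apply: lspan_trans sy => e [eE ey]; apply: lspan_gen; split=> //.
  exact: trans yz.
exists E; set b := (fun e : {x | x \in E} => val e); split.
  suff inj0 g : lin_ext b g = 0 -> g = 0.
    move=> g g' gg'; apply/eqP; rewrite -subr_eq0; apply/eqP/inj0.
    by rewrite linearB /= gg' subrr.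
  move=> g0; have [gE|/fset0Pn [e0 e0g]] := eqVneq (msupp g) fset0.
    by apply/malgP => e; rewrite mcoeff0 mcoeff_outdom // gE in_fset0.
  have mx (s : seq V) x : exists2 y, y \in x :: s &
      forall z, z \in x :: s -> le z y.
    elim: s x => [|y s IH] x.
      exists x; rewrite ?mem_head // => z; rewrite inE => /eqP ->.
      by rewrite -[le _ _]orbb tot.
    have [w wy wmax] := IH y; have /orP[xw|wx] := tot x w.
      exists w; first by rewrite inE wy orbT.
      by move=> z; rewrite inE => /orP[/eqP ->//|/wmax].
    exists x; rewrite ?mem_head // => z; rewrite inE => /orP[/eqP ->|/wmax zw].
      by rewrite -[le _ _]orbb tot.
    exact: trans zw wx.
  have [y] := mx (map b (msupp g)) (b e0).
  rewrite -[_ :: _]/(map b (e0 :: _)) => /mapP [e].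
  rewrite inE => /orP e' ye; have {e'} eg : e \in msupp g by case: e' => [/eqP ->|].
  move=> ymax; have {ymax} emax e' : e' \in msupp g -> le (val e') (val e).
    by move=> e'g; rewrite -[val e]ye; apply/ymax/map_f; rewrite inE e'g orbT.
  have /asboolP [] := valP e.
  have -> : val e = lin_ext b (<< e >> - (g@_e)^-1 *: g).
    by rewrite linearB linearZ /= g0 scaler0 subr0 lin_extU.
  apply: lspan_lin_ext => e'.
  rewrite -mcoeff_neq0 mcoeffB mcoeffZ mcoeffU /lt /b => ne.
  have [ee'|ee'] := eqVneq e e'.
    move: ne; rewrite -ee' eqxx mulr1n mulVf ?subrr ?eqxx // mcoeff_neq0 //.
  have e'g : e' \in msupp g.
    move: ne; rewrite (negPf ee') mulr0n sub0r oppr_eq0 mulf_eq0 negb_or mcoeff_neq0.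
    by case/andP.
  rewrite linearB linearZ /= g0 scaler0 subr0 lin_extU emax //=.
  by apply: contra ee' => /eqP ee; apply/eqP/val_inj.
move=> x; suff H y : lspan (fun e => e \in E /\ le e x) y -> exists g,
    lin_ext b g = y /\ forall e, e \in msupp g -> (rk (val e) <= rk x)%N.
  exact: H (sE x).
elim=> [|c e z [eE ex] _ [g [gz gx]]].
  by exists 0; rewrite linear0 msupp0; split.
exists (c *: << exist _ e eE : {x | x \in E} >> + g); split.
  by rewrite linearP /= lin_extU -gz.
move=> e' /(fsubsetP (msuppD_le _ _)); rewrite in_fsetU => /orP[|/gx //].
move=> /(fsubsetP (msuppZ_le _ _)) /(fsubsetP msuppU_le).
by rewrite in_fset1 => /eqP ->; exact: le_rk.
Qed.

End AdaptedBasis.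

(** Turns membership in a subspace into the vanishing of a linear map, so that statements about
    spans can be proved by applying results on forms to a form with values in the quotient. *)
Lemma quotient_by (k : fieldType) (V : lmodType k) (P : V -> Prop) :
    P 0 -> (forall c x y, P x -> P y -> P (c *: x + y)) ->
  exists (X : lmodType k) (q : {linear V -> X}), forall x, q x = 0 <-> P x.
Proof.
move=> P0 Plin; pose Sp : {pred V} := fun x => `[< P x >].
have SpC : submod_closed Sp.
  split=> [|c x y /asboolP Px /asboolP Py]; apply/asboolP => //.
  exact: Plin.
exists (quot_space (Subspace SpC)), (quot_proj (Subspace SpC)) => x.
have -> : quot_proj (Subspace SpC) x = 0 <-> x \in Subspace SpC.
  rewrite -(linear0 (quot_proj _)); split=> [/quot_projP|xS].
    by rewrite subr0.
  by apply/quot_projP; rewrite subr0.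
by split=> [/asboolP|] // Px; apply/asboolP.
Qed.

(** * Free algebras of the variety *)

Definition bilin (k : fieldType) (U V X : lmodType k) (beta : U -> V -> X) :=
  (forall y, linear (beta^~ y)) /\ (forall x, linear (beta x)).

Section Bilin.
Variables (k : fieldType) (U V X : lmodType k) (beta : U -> V -> X).
Hypothesis bl : bilin beta.

Lemma bilin0l y : beta 0 y = 0.
Proof. by have := bl.1 y (-1) 0 0; rewrite !scaleN1r oppr0 addr0 addNr. Qed.

Lemma bilin0r x : beta x 0 = 0.
Proof. by have := bl.2 x (-1) 0 0; rewrite !scaleN1r oppr0 addr0 addNr. Qed.

Lemma bilinDl y : {morph beta^~ y : x x' / x + x'}.
Proof. by move=> x x' /=; have := bl.1 y 1 x x'; rewrite !scale1r. Qed.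

Lemma bilinDr x : {morph beta x : y y' / y + y'}.
Proof. by move=> y y'; have := bl.2 x 1 y y'; rewrite !scale1r. Qed.

Lemma bilinZl c x y : beta (c *: x) y = c *: beta x y.
Proof. by have := bl.1 y c x 0; rewrite addr0 bilin0l addr0. Qed.

Lemma bilinZr c x y : beta x (c *: y) = c *: beta x y.
Proof. by have := bl.2 x c y 0; rewrite addr0 bilin0r addr0. Qed.

Lemma bilinBl x x' y : beta (x - x') y = beta x y - beta x' y.
Proof. by rewrite bilinDl -scaleN1r bilinZl scaleN1r. Qed.

Lemma bilinBr x y y' : beta x (y - y') = beta x y - beta x y'.
Proof. by rewrite bilinDr -scaleN1r bilinZr scaleN1r. Qed.

End Bilin.

Section QuadProduct.
Variables (k : fieldType) (A : nalg k).

Lemma nalg_mul_bilin : bilin (@nalg_mul k A).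
Proof. split; [exact: nalg_mul_linearl | exact: nalg_mul_linearr]. Qed.

Definition quad (a b c d : A) : A := (a ∙ b) ∙ (c ∙ d).

Definition commutator5 (X : lmodType k) (beta : A -> A -> X) a b c d e : X :=
  beta a (quad b c d e) - beta (quad b c d e) a.

Lemma commutator5_linear (X : lmodType k) (beta : A -> A -> X) :
  bilin beta -> linear5 (commutator5 beta).
Proof.
move=> bl; rewrite /commutator5 /quad.
have sub (c : k) (u v u' v' : X) : c *: u + v - (c *: u' + v') = c *: (u - u') + (v - v').
  by rewrite opprD addrACA scalerBr.
split=> [b c d e t x y|a c d e t x y|a b d e t x y|a b c e t x y|a b c d t x y].
- by rewrite bl.1 bl.2 sub.
- by rewrite !nalg_mul_linearl bl.1 bl.2 sub.
- by rewrite nalg_mul_linearr !nalg_mul_linearl bl.1 bl.2 sub.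
- by rewrite nalg_mul_linearl !nalg_mul_linearr bl.1 bl.2 sub.
- by rewrite !nalg_mul_linearr bl.1 bl.2 sub.
Qed.

Definition balanced (X : lmodType k) (beta : A -> A -> X) (x : A) : Prop :=
  beta x (quad x x x x) = beta (quad x x x x) x.

End QuadProduct.

(* [cover] stands for the free non-associative algebra; as an interface, this *)
(* also applies to every algebra isomorphic to a free one.                    *)
Record presentation (k : fieldType) (Z : choiceType) (F : nalg k) := Presentation {
  cover : nalg k;
  mono : magma Z -> cover;
  ext : forall X : lmodType k, (magma Z -> X) -> {linear cover -> X};
  pres : nalg_hom cover F;
  monoM : forall a b, mono (Mul a b) = mono a ∙ mono b;
  ext_mono : forall (X : lmodType k) (h : magma Z -> X) a, ext h (mono a) = h a;
  cover_ind : forall P : cover -> Prop,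
    P 0 -> (forall a, P (mono a)) ->
    (forall c x y, P x -> P y -> P (c *: x + y)) -> forall x, P x;
  pres_surj : forall x, exists p, pres p = x;
  pres_in_M : in_M F;
  pres_ker_ind : forall P : cover -> Prop,
    (forall x, P (x ∙ quad x x x x - quad x x x x ∙ x)) ->
    (forall c x y, P x -> P y -> P (c *: x + y)) ->
    (forall x y, P y -> P (x ∙ y)) -> (forall x y, P x -> P (x ∙ y)) ->
    forall p, pres p = 0 -> P p
}.

Section FreePresentation.
Variables (k : fieldType) (Z : choiceType).
Local Notation T := (free_nalg k Z).
Local Notation F := (free_M_nalg k Z).
Local Notation I := (consequence_ideal k Z).

Definition free_mono (a : magma Z) : T := << a >>.

Definition free_ext (X : lmodType k) (h : magma Z -> X) : {linear T -> X} :=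
  lin_ext h.

Lemma free_monoM a b : free_mono (Mul a b) = free_mono a ∙ free_mono b.
Proof. by rewrite /= /free_mul !lin_extU. Qed.

Lemma free_projM : {morph (quot_proj I : T -> F) : x y / x ∙ y}.
Proof. by move=> x y; exact/esym/quot_nmulE. Qed.

Definition free_proj : nalg_hom T F :=
  @NAlgHom k T F (quot_proj I) free_projM.

Lemma free_proj_eq0 (p : T) : free_proj p = 0 -> consequence p.
Proof.
rewrite -(linear0 (quot_proj I)) => /quot_projP.
by rewrite subr0 => /asboolP.
Qed.

Lemma free_proj_surj (x : F) : exists p, free_proj p = x.
Proof. by exists (repr x); exact: quot_projK. Qed.

Definition free_presentation : presentation Z F.
Proof.
refine (@Presentation k Z F T free_mono free_ext free_proj free_monoM
  _ _ free_proj_surj (@free_M_nalgP k Z) _).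
- by move=> X h a; exact: lin_extU.
- exact: malg_ind.
- move=> P Pid Plin Pl Pr p /free_proj_eq0.
  by elim=> *; [exact: Pid | exact: Plin | exact: Pl | exact: Pr].
Defined.

End FreePresentation.

Lemma nalg_hom_inv (k : fieldType) (A B : nalg k) (f : nalg_hom A B) :
  bijective f -> exists g : nalg_hom B A, cancel f g /\ cancel g f.
Proof.
case=> g fK gK.
have glin : linear g by move=> c x y; apply: (can_inj fK); rewrite linearP !gK.
have gM : {morph g : x y / x ∙ y}.
  by move=> x y; apply: (can_inj fK); rewrite nalg_homM !gK.
pose gl : {linear B -> A} := HB.pack g (GRing.isLinear.Build k B A *:%R g glin).
by exists (@NAlgHom k B A gl gM).
Qed.

Lemma is_free_presentation (k : fieldType) (A : nalg k) :
  is_free A -> exists Z : choiceType, inhabited (presentation Z A).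
Proof.
case=> Z [f fbij]; exists Z; constructor.
have [g [fK gK]] := cid (nalg_hom_inv fbij).
have FP := free_presentation k Z.
have prM : {morph (g \o pres FP) : x y / x ∙ y}.
  by move=> x y /=; rewrite !nalg_homM.
pose pr := @NAlgHom k _ _ (g \o pres FP : {linear cover FP -> A}) prM.
refine (@Presentation k Z A (cover FP) (@mono _ _ _ FP) (ext FP) pr
  (monoM FP) (ext_mono FP) (@cover_ind _ _ _ FP) _ _ _).
- move=> x; have [p px] := pres_surj FP (f x).
  by exists p; rewrite /= px fK.
- by move=> x; apply: (can_inj fK); rewrite !nalg_homM; exact: pres_in_M FP _.
- move=> P Pid Plin Pl Pr p pr0; apply: (@pres_ker_ind _ _ _ FP) => //.
  by apply: (can_inj gK); rewrite linear0.
Qed.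

(** * Universal property of a presented algebra, and balanced forms on it *)

Section PresentationTheory.
Variables (k : fieldType) (Z : choiceType) (F : nalg k).
Variable FP : presentation Z F.
Local Notation T := (cover FP).
Local Notation pr := (pres FP).
Local Notation mono := (mono FP).

Lemma pres_factor (X : lmodType k) (f : {linear T -> X}) :
  (forall p, pr p = 0 -> f p = 0) ->
  exists g : {linear F -> X}, forall p, g (pr p) = f p.
Proof.
move=> f0; have [s sK] := choice (pres_surj FP).
have E p : f (s (pr p)) = f p.
  by apply/eqP; rewrite -subr_eq0 -linearB f0 // linearB /= sK subrr.
have glin : linear (f \o s).
  move=> c x y /=; rewrite -{1}(sK x) -{1}(sK y) -linearP E.
  by rewrite linearP.
pose g : {linear F -> X} :=
  HB.pack (f \o s) (GRing.isLinear.Build k F X *:%R (f \o s) glin).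
by exists g.
Qed.

Section Eval.
Variables (C : nalg k) (CM : in_M C) (h : Z -> C).

Fixpoint magma_eval (t : magma Z) : C :=
  match t with
  | Gen z => h z
  | Mul a b => magma_eval a ∙ magma_eval b
  end.

Lemma ext_magma_evalM (p q : T) :
  ext FP magma_eval (p ∙ q) = ext FP magma_eval p ∙ ext FP magma_eval q.
Proof.
have CB := nalg_mul_bilin C; have TB := nalg_mul_bilin T.
elim/(@cover_ind _ _ _ FP): p => [|a|c x y IHx IHy].
- by rewrite (bilin0l TB) linear0 (bilin0l CB).
- elim/(@cover_ind _ _ _ FP): q => [|b|c x y IHx IHy].
  + by rewrite (bilin0r TB) linear0 (bilin0r CB).
  + by rewrite -monoM !ext_mono.
  + by rewrite nalg_mul_linearr !linearP /= IHx IHy nalg_mul_linearr.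
- by rewrite nalg_mul_linearl !linearP /= IHx IHy nalg_mul_linearl.
Qed.

Lemma pres_eval :
  exists f : nalg_hom F C, forall p, f (pr p) = ext FP magma_eval p.
Proof.
have CB := nalg_mul_bilin C.
have [|f fE] := @pres_factor C (ext FP magma_eval).
  apply: (@pres_ker_ind _ _ _ FP) => [x|c x y hx hy|x y hy|x y hx].
  - by rewrite linearB /= !ext_magma_evalM CM subrr.
  - by rewrite linearP /= hx hy scaler0 addr0.
  - by rewrite ext_magma_evalM hy (bilin0r CB).
  - by rewrite ext_magma_evalM hx (bilin0l CB).
have fM : {morph f : x y / x ∙ y}.
  move=> x y; have [p <-] := pres_surj FP x; have [q <-] := pres_surj FP y.
  by rewrite -nalg_homM !fE ext_magma_evalM.
by exists (NAlgHom fM).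
Qed.

End Eval.

Fixpoint magma_size (t : magma Z) : nat :=
  match t with Gen _ => 1 | Mul a b => magma_size a + magma_size b end.

Lemma magma_size_gt0 t : (0 < magma_size t)%N.
Proof. by elim: t => //= a IHa b _; rewrite addn_gt0 IHa. Qed.

Definition fle (m : nat) (x : F) : Prop :=
  lspan (fun y => exists2 t, pr (mono t) = y & (magma_size t <= m)%N) x.

(* A balanced form on a free algebra comes from a linear map, because the     *)
(* balanced forms are the square-zero extensions inside the variety.          *)
Lemma balanced_form (X : lmodType k) (beta : F -> F -> X) :
    bilin beta -> (forall x, balanced beta x) ->
  exists l : {linear F -> X}, (forall x y, l (x ∙ y) = beta x y) /\
    forall m, (forall x y i j, fle i x -> fle j y -> (i + j <= m)%N ->
                 beta x y = 0) ->
    forall x, fle m x -> l x = 0.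
Proof.
move=> bl bal; have TB := nalg_mul_bilin T.
(* The values on generators are free; 0 is chosen so that the filtered vanishing also holds in
   degree one. *)
pose h t := match t with
            | Gen _ => 0
            | Mul a b => beta (pr (mono a)) (pr (mono b))
            end.
have hM p q : ext FP h (p ∙ q) = beta (pr p) (pr q).
  elim/(@cover_ind _ _ _ FP): p => [|a|c x y IHx IHy].
  - by rewrite (bilin0l TB) !linear0 (bilin0l bl).
  - elim/(@cover_ind _ _ _ FP): q => [|b|c x y IHx IHy].
    + by rewrite (bilin0r TB) !linear0 (bilin0r bl).
    + by rewrite -monoM ext_mono.
    + by rewrite nalg_mul_linearr !linearP /= IHx IHy bl.2.
  - by rewrite nalg_mul_linearl !linearP /= IHx IHy bl.1.
have [|l lE] := @pres_factor X (ext FP h).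
  (* The induction keeps [pr p = 0] alongside: it makes the form vanish on products with an element
     of the ideal. *)
  move=> p p0; suff [] : pr p = 0 /\ ext FP h p = 0 by [].
  move: p p0; have FB := nalg_mul_bilin F.
  apply: (@pres_ker_ind _ _ _ FP).
  - move=> x; rewrite !linearB /= !hM !nalg_homM (pres_in_M FP) // bal.
    by rewrite !subrr.
  - by move=> c x y [x0 hx] [y0 hy]; rewrite !linearP /= x0 y0 hx hy !scaler0 !addr0.
  - by move=> x y [y0 _]; rewrite nalg_homM hM y0 (bilin0r FB) (bilin0r bl).
  - by move=> x y [x0 _]; rewrite nalg_homM hM x0 (bilin0l FB) (bilin0l bl).
exists l; split=> [x y|m b0 x].
  have [p <-] := pres_surj FP x; have [q <-] := pres_surj FP y.
  by rewrite -nalg_homM lE hM.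
elim=> [|c y z [t <- tm] _ IH]; first exact: linear0.
rewrite linearP IH lE ext_mono addr0; case: t tm => [u _|a b tm] /=.
  by rewrite scaler0.
by rewrite (b0 _ _ (magma_size a) (magma_size b)) ?scaler0 //; apply: lspan_gen;
  [exists a | exists b].
Qed.

End PresentationTheory.

(** * Degree filtrations and homogeneity of the relations *)

Section Grading.
Variables (k : fieldType) (Z : choiceType) (F : nalg k).
Variable FP : presentation Z F.
Local Notation T := (cover FP).
Local Notation pr := (pres FP).
Local Notation mono := (mono FP).
Local Notation fle := (fle FP).

Lemma fle_mono i j x : (i <= j)%N -> fle i x -> fle j x.
Proof.
move=> ij; apply: lspan_trans => _ [t <- ti]; apply: lspan_gen.
by exists t; rewrite ?(leq_trans ti).
Qed.

Lemma fle_ex x : exists m, fle m x.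
Proof.
have [p <-] := pres_surj FP x.
elim/(@cover_ind _ _ _ FP): p => [|a|c y z [i iy] [j jz]].
- by exists 0%N; rewrite linear0; exact: lspan0.
- by exists (magma_size a); apply: lspan_gen; exists a.
- exists (maxn i j); rewrite linearP; apply: lspan_lin.
  + by apply: fle_mono iy; rewrite leq_maxl.
  + by apply: fle_mono jz; rewrite leq_maxr.
Qed.

Lemma fle0 x : fle 0 x -> x = 0.
Proof.
elim=> [//|c y z [t _ t0]].
by move: t0; rewrite leqNgt magma_size_gt0.
Qed.

Lemma lspan_mul (Q1 Q2 Q : F -> Prop) x y :
    (forall u v, Q1 u -> Q2 v -> Q (u ∙ v)) ->
  lspan Q1 x -> lspan Q2 y -> lspan Q (x ∙ y).
Proof.
have FB := nalg_mul_bilin F; move=> QM Q1x Q2y.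
elim: Q1x => [|c u x' Qu _ IHx]; first by rewrite (bilin0l FB); exact: lspan0.
rewrite nalg_mul_linearl; apply: lspan_lin => //.
elim: Q2y => [|d v y' Qv _ IHy]; first by rewrite (bilin0r FB); exact: lspan0.
by rewrite nalg_mul_linearr; apply: lspan_lin => //; apply/lspan_gen/QM.
Qed.

Lemma fle_mul i j x y : fle i x -> fle j y -> fle (i + j) (x ∙ y).
Proof.
apply: lspan_mul => _ _ [a <- ai] [b <- bj].
by exists (Mul a b); rewrite ?monoM ?nalg_homM //= leq_add.
Qed.

Definition fge (m : nat) (x : F) : Prop :=
  lspan (fun y => exists2 t, pr (mono t) = y & (m <= magma_size t)%N) x.

Lemma fge_mul i j x y : fge i x -> fge j y -> fge (i + j) (x ∙ y).
Proof.
apply: lspan_mul => _ _ [a <- ai] [b <- bj].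
by exists (Mul a b); rewrite ?monoM ?nalg_homM //= leq_add.
Qed.

Lemma fge1 x : fge 1 x.
Proof.
have [p <-] := pres_surj FP x.
elim/(@cover_ind _ _ _ FP): p => [|a|c y z yP zP].
- by rewrite linear0; exact: lspan0.
- by apply: lspan_gen; exists a; rewrite ?magma_size_gt0.
- by rewrite linearP; exact: lspan_lin.
Qed.

Lemma cover_expand (p : T) : exists n (c : 'I_n -> k) (t : 'I_n -> magma Z),
  p = \sum_i c i *: mono (t i).
Proof.
elim/(@cover_ind _ _ _ FP): p => [|a|c x y [n1 [c1 [t1 ->]]] [n2 [c2 [t2 ->]]]].
- have t0 : 'I_0 -> magma Z by case.
  by exists 0%N, (fun=> 0), t0; rewrite big_ord0.
- by exists 1%N, (fun=> 1), (fun=> a); rewrite big_ord1 scale1r.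
- exists (n1 + n2)%N,
    (fun i => match split i with inl j => c * c1 j | inr j => c2 j end),
    (fun i => match split i with inl j => t1 j | inr j => t2 j end).
  rewrite big_split_ord scaler_sumr; congr (_ + _); apply: eq_bigr => i _.
    by rewrite (unsplitK (inl _ i)) scalerA.
  by rewrite (unsplitK (inr _ i)).
Qed.

Definition component (n : nat) : {linear T -> T} :=
  ext FP (fun t => if magma_size t == n then mono t else 0).

Lemma component_mulU n a y :
  component n (mono a ∙ y) =
  if (magma_size a <= n)%N then mono a ∙ component (n - magma_size a) y else 0.
Proof.
have TB := nalg_mul_bilin T.
elim/(@cover_ind _ _ _ FP): y => [|b|c x y IHx IHy].
- by rewrite !(linear0, bilin0r TB) if_same.
- rewrite -monoM /component !ext_mono /=; case: leqP => an.
    rewrite -{1}(subnKC an) eqn_add2l; case: eqP => _; first exact: monoM.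
    by rewrite (bilin0r TB).
  by rewrite gtn_eqF // ltn_addr.
- rewrite nalg_mul_linearr !linearP /= IHx IHy; case: ifP => _.
    by rewrite nalg_mul_linearr.
  by rewrite scaler0 addr0.
Qed.

Lemma component_mulUr n b x :
  component n (x ∙ mono b) =
  if (magma_size b <= n)%N then component (n - magma_size b) x ∙ mono b else 0.
Proof.
have TB := nalg_mul_bilin T.
elim/(@cover_ind _ _ _ FP): x => [|a|c x y IHx IHy].
- by rewrite !(linear0, bilin0l TB) if_same.
- rewrite -monoM /component !ext_mono /=; case: leqP => bn.
    rewrite -{1}(subnK bn) eqn_add2r; case: eqP => _; first exact: monoM.
    by rewrite (bilin0l TB).
  by rewrite gtn_eqF // ltn_addl.
- rewrite nalg_mul_linearl !linearP /= IHx IHy; case: ifP => _.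
    by rewrite nalg_mul_linearl.
  by rewrite scaler0 addr0.
Qed.

Hypothesis char0 : [pchar k] =i pred0.

(** The ideal of consequences is homogeneous. The identity is not multilinear, so a homogeneous part
    of one of its values is not literally a value; but expanded in monomials, the part of degree n
    is cut out by a condition on the total degree, which is symmetric in the five positions, and
    [sum_sym_eq0] applies. *)
Lemma component_ker n p : pr p = 0 -> pr (component n p) = 0.
Proof.
have FB := nalg_mul_bilin F; have TB := nalg_mul_bilin T.
move=> p0; move: p p0 n; apply: (@pres_ker_ind _ _ _ FP).
- move=> x n; have [N [c [t xE]]] := cover_expand x.
  have Tlin := commutator5_linear TB.
  rewrite -[_ - _]/(commutator5 (@nalg_mul k T) x x x x x).
  rewrite (app5_expand Tlin xE) !linear_sum /=.
  pose S (h : {ffun 'I_5 -> 'I_N}) := (\sum_i magma_size (t (h i)))%N.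
  pose beta (a b : T) := (pr a : F) ∙ (pr b : F).
  have Bbl : bilin beta.
    by split=> y d u v; rewrite /beta linearP ?nalg_mul_linearl ?nalg_mul_linearr.
  rewrite (eq_bigr (fun h : {ffun 'I_5 -> 'I_N} =>
     ((\prod_i c (h i)) * (S h == n)%:R)
       *: app5 (commutator5 beta) ((fun i => mono (t i)) \o h))).
    apply: sum_sym_eq0 => //.
    + exact: commutator5_linear.
    + move=> y; rewrite /commutator5 /beta !nalg_homM (pres_in_M FP).
      by rewrite subrr.
    + move=> h s sI; have [s' sK s'K] := injF_bij sI.
      rewrite /S (reindex s') /=; last by exists s => i _.
      rewrite [X in (X == n)](reindex s') /=; last by exists s => i _.
      congr (_ * (_ == n)%:R); apply: eq_bigr => i _; by rewrite ffunE s'K.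
  move=> h _; rewrite !linearZ /= -scalerA; congr (_ *: _).
  rewrite /app5 /commutator5 /quad /= -!monoM linearB /= /component !ext_mono /=.
  have -> : S h = (magma_size (t (h i0)) + (magma_size (t (h i1)) + magma_size (t (h i2)) +
      (magma_size (t (h i3)) + magma_size (t (h i4)))))%N.
    rewrite /S !big_ord_recl big_ord0 addn0 !addnA.
    by do 4?congr addn; congr (magma_size (t (h _))); apply: val_inj.
  rewrite [X in if X == n then mono (Mul (Mul _ _) _) else _]addnC.
  case: ifP => _; last by rewrite subrr linear0 scale0r.
  by rewrite scale1r !monoM linearB /= /beta !nalg_homM.
- by move=> c x y hx hy n; rewrite !linearP /= hx hy scaler0 addr0.
- move=> x y hy n; elim/(@cover_ind _ _ _ FP): x => [|a|c u v hu hv].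
  + by rewrite (bilin0l TB) !linear0.
  + rewrite component_mulU; case: ifP => _; last exact: linear0.
    by rewrite nalg_homM hy (bilin0r FB).
  + by rewrite nalg_mul_linearl !linearP /= hu hv scaler0 addr0.
- move=> x y hx n; elim/(@cover_ind _ _ _ FP): y => [|a|c u v hu hv].
  + by rewrite (bilin0r TB) !linear0.
  + rewrite component_mulUr; case: ifP => _; last exact: linear0.
    by rewrite nalg_homM hx (bilin0l FB).
  + by rewrite nalg_mul_linearr !linearP /= hu hv scaler0 addr0.
Qed.

Lemma sum_component p :
  exists N, forall M, (N <= M)%N -> \sum_(n < M) component n p = p.
Proof.
elim/(@cover_ind _ _ _ FP): p => [|a|c x y [i ix] [j jy]].
- by exists 0%N => M _; apply: big1 => n _; exact: linear0.
- exists (magma_size a).+1 => M aM; rewrite (bigD1 (Ordinal aM)) //= big1 ?addr0.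
    by rewrite /component ext_mono eqxx.
  move=> n; rewrite /component ext_mono => na.
  by case: eqP => // an; case/eqP: na; exact/val_inj/esym.
- exists (maxn i j) => M; rewrite geq_max => /andP[iM jM].
  rewrite (eq_bigr (fun n : 'I_M => c *: component n x + component n y)).
    by rewrite big_split -scaler_sumr /= ix // jy.
  by move=> n _; rewrite linearP.
Qed.

Lemma fge_lift m x : fge m x -> exists2 q, pr q = x &
  forall n, (n < m)%N -> component n q = 0.
Proof.
elim=> [|c _ y [t <- mt] _ [q <- qm]].
  by exists 0 => [|n _]; exact: linear0.
exists (c *: mono t + q) => [|n nm]; first by rewrite linearP.
rewrite linearP /= qm // /component ext_mono.
by rewrite gtn_eqF ?scaler0 ?addr0 // (leq_trans nm).
Qed.

(** A preimage of x can be compared in each degree n with one that has no component there; by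
    homogeneity every component of the preimage maps to zero. *)
Lemma fge_residual x : (forall m, fge m x) -> x = 0.
Proof.
move=> xm; have [p px] := pres_surj FP x.
have c0 n : pr (component n p) = 0.
  have [q qx q0] := fge_lift (xm n.+1).
  have := component_ker (p := p - q) n.
  by rewrite !linearB /= px qx subrr q0 // linear0 subr0; apply.
have [N /(_ N (leqnn N)) pE] := sum_component p.
by rewrite -px -pE linear_sum big1 // => n _; exact: c0.
Qed.

End Grading.

(** * Balanced forms on subalgebras of free algebras *)

Lemma lt_sum4 (a b c d : nat) :
    (0 < a)%N -> (0 < b)%N -> (0 < c)%N -> (0 < d)%N ->
  let s := (a + b + (c + d))%N in [/\ a < s, b < s, c < s & d < s]%N.
Proof. by move=> *; split; lia. Qed.

Section CoreLemma.
Variables (k : fieldType) (A : nalg k) (E : choiceType).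
Hypothesis char0 : [pchar k] =i pred0.
Variables (b : E -> A) (co : {linear A -> {malg k[E]}}).
Hypothesis coK : forall x, lin_ext b (co x) = x.
Hypothesis co_b : forall u, co (b u) = << u >>.
Variable deg : E -> nat.
Hypothesis deg_gt0 : forall u, (0 < deg u)%N.
Variable fle : nat -> A -> Prop.
Hypothesis fleP : forall m x,
  fle m x <-> forall u, (co x)@_u != 0 -> (deg u <= m)%N.
Hypothesis fleM : forall i j x y, fle i x -> fle j y -> fle (i + j) (x ∙ y).
Hypothesis form_ext : forall (X : lmodType k) (beta : A -> A -> X),
    bilin beta -> (forall x, balanced beta x) ->
  exists l : {linear A -> X}, (forall x y, l (x ∙ y) = beta x y) /\
    forall m, (forall x y i j, fle i x -> fle j y -> (i + j <= m)%N ->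
                 beta x y = 0) ->
    forall x, fle m x -> l x = 0.
Variable inB : pred E.
Definition inS (x : A) : Prop := forall u, (co x)@_u != 0 -> inB u.
Hypothesis inSM : forall x y, inS x -> inS y -> inS (x ∙ y).

Lemma co_bE u v : (co (b u))@_v = (u == v)%:R.
Proof. by rewrite co_b mcoeffU. Qed.

Lemma fle_b u : fle (deg u) (b u).
Proof. by apply/fleP => v; rewrite co_bE; case: (u =P v) => [->|]; rewrite ?eqxx. Qed.

Lemma inS_b u : inB u -> inS (b u).
Proof. by move=> uB v; rewrite co_bE; case: (u =P v) => [<-|]; rewrite ?eqxx. Qed.

Lemma inS_lin c x y : inS x -> inS y -> inS (c *: x + y).
Proof.
move=> xS yS u; rewrite linearP /= mcoeffD mcoeffZ.
have [->|/xS//] := eqVneq (co x)@_u 0.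
by rewrite mulr0 add0r => /yS.
Qed.

Lemma inS_quad x y z t : inS x -> inS y -> inS z -> inS t -> inS (quad x y z t).
Proof. by move=> xS yS zS tS; apply: inSM; exact: inSM. Qed.

(** The tensor product, with the tensor square realised as the space with basis [E * E] so that
    tensors can be compared coefficient by coefficient. *)
Definition tens0 (g h : {malg k[E]}) : {malg k[(E * E)%type]} :=
  lin_ext (fun u => lin_ext (fun v => << (u, v) >>) h) g.

Lemma tens0_coeff g h u v : (tens0 g h)@_(u, v) = g@_u * h@_v.
Proof.
rewrite /tens0; elim/malg_ind: g => [|u'|c x y IHx IHy].
- by rewrite linear0 !mcoeff0 mul0r.
- rewrite lin_extU; elim/malg_ind: h => [|v'|c x y IHx IHy].
  + by rewrite linear0 !mcoeff0 mulr0.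
  + by rewrite lin_extU !mcoeffU xpair_eqE -mulnb natrM.
  + by rewrite linearP !mcoeffD !mcoeffZ /= IHx IHy; ring.
- by rewrite linearP !mcoeffD !mcoeffZ /= IHx IHy; ring.
Qed.

Definition tens (x y : A) := tens0 (co x) (co y).

Lemma tens_coeff x y u v : (tens x y)@_(u, v) = (co x)@_u * (co y)@_v.
Proof. exact: tens0_coeff. Qed.

Lemma tens_bilin : bilin tens.
Proof.
split=> [y|x] c u v; rewrite /tens linearP; first exact: lin_ext_is_linear.
by apply: lin_ext_fun => a; exact: lin_ext_is_linear.
Qed.

Section Functional.
Variables (X : lmodType k) (beta : A -> A -> X).
Hypothesis bl : bilin beta.

Definition tens_lift : {linear {malg k[(E * E)%type]} -> X} :=
  lin_ext (fun p => beta (b p.1) (b p.2)).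

Lemma tens_liftE x y : tens_lift (tens x y) = beta x y.
Proof.
rewrite -{2}(coK x) -{2}(coK y) /tens /tens0.
elim/malg_ind: (co x) => [|u|c g1 g2 IH1 IH2].
- by rewrite !linear0 (bilin0l bl).
- rewrite !lin_extU; elim/malg_ind: (co y) => [|v|c g1 g2 IH1 IH2].
  + by rewrite !linear0 (bilin0r bl).
  + by rewrite /= !lin_extU.
  + by rewrite !linearP /= IH1 IH2 bl.2.
- by rewrite !linearP /= IH1 IH2 bl.1.
Qed.

End Functional.

Local Opaque tens.

Lemma commutator5_coeff x1 x2 x3 x4 x5 u v :
  (commutator5 tens x1 x2 x3 x4 x5)@_(u, v) =
  (co x1)@_u * (co (quad x2 x3 x4 x5))@_v
  - (co (quad x2 x3 x4 x5))@_u * (co x1)@_v.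
Proof.
apply: etrans (mcoeffB _ _ _) _.
by congr (_ - _); exact: tens_coeff.
Qed.

(** Divide the tensor square by the tensors of the identity and by everything of total degree at
    most m. The resulting form is balanced, hence comes from a linear map; that map kills degree at
    most m since the form kills the pairs of such degree. *)
Lemma relation_tensors m (s : seq (A * A)) :
    fle m (\sum_(p <- s) p.1 ∙ p.2) ->
  exists r : seq (k * A), forall u v, (m < deg u + deg v)%N ->
    (\sum_(p <- s) tens p.1 p.2)@_(u, v) =
    (\sum_(c <- r) c.1 *: commutator5 tens c.2 c.2 c.2 c.2 c.2)@_(u, v).
Proof.
pose R (r : seq (k * A)) :=
  \sum_(c <- r) c.1 *: commutator5 tens c.2 c.2 c.2 c.2 c.2.
pose RP (t : {malg k[(E * E)%type]}) :=
  exists r, forall u v, (m < deg u + deg v)%N -> t@_(u, v) = (R r)@_(u, v).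
have R0 : RP 0 by exists [::] => u v _; rewrite /R big_nil.
have Rlin c x y : RP x -> RP y -> RP (c *: x + y).
  move=> [r1 h1] [r2 h2]; exists ([seq (c * d.1, d.2) | d <- r1] ++ r2) => u v uv.
  rewrite mcoeffD mcoeffZ h1 // h2 // /R big_cat big_map mcoeffD /=.
  under [in RHS]eq_bigr do rewrite -scalerA.
  by rewrite -scaler_sumr mcoeffZ.
have [X [q q0]] := quotient_by R0 Rlin.
pose beta x y := q (tens x y).
have bl : bilin beta.
  by split=> y c u v; rewrite /beta ?tens_bilin.1 ?tens_bilin.2 linearP.
have [|l [lM l0]] := form_ext bl.
  move=> x; apply/eqP; rewrite -subr_eq0 -linearB; apply/eqP/q0.
  by exists [:: (1, x)] => u v _; rewrite /R big_seq1 scale1r.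
move=> sm; have := l0 m _ _ sm; rewrite linear_sum.
have -> : \sum_(p <- s) l (p.1 ∙ p.2) = q (\sum_(p <- s) tens p.1 p.2).
  by rewrite linear_sum; apply: eq_bigr => p _; rewrite lM.
move=> H; apply/q0/H => x y i j /fleP xi /fleP yj ij.
apply/q0; exists [::] => u v uv.
rewrite /R big_nil mcoeff0 tens_coeff.
have [->|/xi ui] := eqVneq (co x)@_u 0; first by rewrite mul0r.
have [->|/yj vj] := eqVneq (co y)@_v 0; first by rewrite mulr0.
by move: uv; rewrite ltnNge (leq_trans (leq_add ui vj)).
Qed.

Definition symmetric5 (D : finType) (T : {ffun 'I_5 -> D} -> k) : Prop :=
  forall (h : {ffun 'I_5 -> D}) (s : 'I_5 -> 'I_5), injective s ->
    T [ffun i => h (s i)] = T h.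

Lemma common_support (r : seq (k * A)) :
  exists d : {fset E}, forall c, c \in r -> (msupp (co c.2) `<=` d)%fset.
Proof.
elim: r => [|c r [d dP]]; first by exists fset0.
exists (msupp (co c.2) `|` d)%fset => c'; rewrite inE => /orP[/eqP ->|/dP c'd].
  exact: fsubsetUl.
by apply: fsubset_trans c'd _; exact: fsubsetUr.
Qed.

(** A combination of fifth powers, expanded in the finitely many basis elements involved; [T h] sums
    the products of coordinates, which is visibly symmetric. *)
Lemma symmetric_tensor (r : seq (k * A)) :
  exists (D : finType) (e : D -> E) (T : {ffun 'I_5 -> D} -> k),
  [/\ injective e, symmetric5 T &
    forall (X : lmodType k) (P : A -> A -> A -> A -> A -> X), linear5 P ->
      \sum_(c <- r) c.1 *: P c.2 c.2 c.2 c.2 c.2 =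
      \sum_h T h *: app5 P ((b \o e) \o h)].
Proof.
have [d dP] := common_support r.
pose e (x : d) : E := val x.
pose T (h : {ffun 'I_5 -> d}) := \sum_(c <- r) c.1 * \prod_i (co c.2)@_(e (h i)).
exists d, e, T; split; first exact: val_inj.
  move=> h s sI; have [s' sK s'K] := injF_bij sI.
  apply: eq_bigr => c _; congr (_ * _).
  rewrite (reindex s') /=; last by exists s => i _.
  by apply: eq_bigr => i _; rewrite ffunE s'K.
move=> X P Plin; rewrite /T.
under [RHS]eq_bigr do rewrite scaler_suml.
rewrite exchange_big /= big_seq [RHS]big_seq; apply: eq_bigr => c cr.
have xE : c.2 = \sum_(i : d) (co c.2)@_(e i) *: (b \o e) i.
  rewrite -{1}(coK c.2) (lin_extEw _ (dP _ cr)).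
  by rewrite big_seq_fsetE.
by rewrite (app5_expand Plin xE) scaler_sumr; apply: eq_bigr => h _; rewrite scalerA.
Qed.

(** * Recovering a symmetric tensor from quadruple products *)

Section SymmetricTensor.
Variables (D : finType) (e : D -> E) (T : {ffun 'I_5 -> D} -> k).
Hypotheses (e_inj : injective e) (Tsym : symmetric5 T).

Definition pair_form (u v : E) (x y : A) : k^o :=
  (co x)@_u * (co y)@_v + (co x)@_v * (co y)@_u.

Lemma pair_form_bilin u v : bilin (pair_form u v).
Proof.
by split=> y c x z; rewrite /pair_form linearP /= !mcoeffD !mcoeffZ
  /GRing.scale /=; ring.
Qed.

(** A symmetric form is trivially balanced, so it is a linear function of the product. *)
Lemma pair_functional u v :
  exists l : {linear A -> k^o}, (forall x y, l (x ∙ y) = pair_form u v x y) /\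
    forall m x, (m < deg u + deg v)%N -> fle m x -> l x = 0.
Proof.
have [|l [lM l0]] := form_ext (pair_form_bilin u v).
  by move=> x; rewrite /balanced /pair_form; ring.
exists l; split=> // m x muv; apply: l0 => {}x y i j /fleP xi /fleP yj ij.
rewrite /pair_form.
have [->|/xi ui] := eqVneq (co x)@_u 0.
  have [->|/yj ui] := eqVneq (co y)@_u 0; first by rewrite mulr0 mul0r addr0.
  have [->|/xi vi] := eqVneq (co x)@_v 0; first by rewrite !mul0r addr0.
  lia.
have [->|/yj vj] := eqVneq (co y)@_v 0; last lia.
have [->|/yj uj] := eqVneq (co y)@_u 0; first by rewrite !mulr0 addr0.
have [->|/xi vi] := eqVneq (co x)@_v 0; first by rewrite mulr0 mul0r addr0.
lia.
Qed.

(** Two pair functionals, combined symmetrically, give again a symmetric form, to which the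
    extension property applies once more. This is the injectivity of g on symmetric 4-tensors, with
    control of the degree. *)
Lemma quad_functional u v w z :
  exists L : {linear A -> k^o},
    (forall a c d f, L (quad a c d f) =
       pair_form u v a c * pair_form w z d f
       + pair_form w z a c * pair_form u v d f) /\
    forall m x, (m < deg u + deg v + (deg w + deg z))%N -> fle m x -> L x = 0.
Proof.
have [l [lM l0]] := pair_functional u v; have [l' [l'M l'0]] := pair_functional w z.
pose beta (x y : A) : k^o := l x * l' y + l' x * l y.
have bl : bilin beta.
  split=> y c x t; rewrite /beta (linearP l) (linearP l') /GRing.scale /=; ring.
have [|L [LM L0]] := form_ext bl.
  by move=> x; rewrite /balanced /beta; ring.
exists L; split=> [a c d f|m x mlt]; first by rewrite /quad LM /beta !lM !l'M.
apply: L0 => {}x y i j xi yj ij; rewrite /beta.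
have [li|li] := ltnP i (deg u + deg v).
  rewrite (l0 _ _ li xi) mul0r add0r.
  have [lj|lj] := ltnP j (deg u + deg v); first by rewrite (l0 _ _ lj yj) mulr0.
  by rewrite (l'0 i) ?mul0r //; lia.
rewrite (l'0 j) ?mulr0 ?add0r //; last by lia.
have [lj|lj] := ltnP j (deg u + deg v); first by rewrite (l0 _ _ lj yj) mulr0.
by rewrite (l'0 i) ?mul0r //; lia.
Qed.

Lemma tup5_eq (g : {ffun 'I_5 -> D}) a c d f h :
  (g == tup5 a c d f h) =
  [&& g i0 == a, g i1 == c, g i2 == d, g i3 == f & g i4 == h].
Proof.
apply/eqP/and5P => [->|[]]; first by rewrite !ffunE /= !eqxx.
by do 5!move=> /eqP <-; rewrite tup5K.
Qed.

Lemma sum_delta (t : {ffun 'I_5 -> D}) : \sum_g T g * (g == t)%:R = T t.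
Proof.
rewrite (bigD1 t) //= eqxx mulr1 big1 ?addr0 // => g /negPf ->.
by rewrite mulr0.
Qed.

Lemma sym_swap (i j : 'I_5) (h : {ffun 'I_5 -> D}) :
  T [ffun l => h (tperm i j l)] = T h.
Proof. by apply: Tsym; exact: perm_inj. Qed.

Lemma T_swap12 a c d f h : T (tup5 a d c f h) = T (tup5 a c d f h).
Proof.
rewrite -(sym_swap i1 i2); congr T; apply/ffunP => i.
by rewrite !ffunE permE; case: i => [[|[|[|[|[|//]]]]] Hi].
Qed.

Lemma T_swap34 a c d f h : T (tup5 a c d h f) = T (tup5 a c d f h).
Proof.
rewrite -(sym_swap i3 i4); congr T; apply/ffunP => i.
by rewrite !ffunE permE; case: i => [[|[|[|[|[|//]]]]] Hi].
Qed.

Lemma T_swap_pairs a c d f h : T (tup5 a f h c d) = T (tup5 a c d f h).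
Proof.
rewrite -(sym_swap i1 i3) -(sym_swap i2 i4); congr T; apply/ffunP => i.
by rewrite !ffunE !permE; case: i => [[|[|[|[|[|//]]]]] Hi].
Qed.

Lemma pair_formE u v x y :
  pair_form (e u) (e v) (b (e x)) (b (e y)) =
  (x == u)%:R * (y == v)%:R + (x == v)%:R * (y == u)%:R.
Proof. by rewrite /pair_form !co_bE !(inj_eq e_inj). Qed.

(* The stabiliser of {{u, v}, {w, z}} in S_4 has order 8. *)
Lemma sum_quad_functional c u v w z (L : {linear A -> k^o}) :
    (forall x y x' y', L (quad x y x' y') =
       pair_form (e u) (e v) x y * pair_form (e w) (e z) x' y'
       + pair_form (e w) (e z) x y * pair_form (e u) (e v) x' y') ->
  \sum_g T g * (g i0 == c)%:R
     * L (quad (b (e (g i1))) (b (e (g i2))) (b (e (g i3))) (b (e (g i4)))) =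
  T (tup5 c u v w z) *+ 8.
Proof.
move=> LE.
pose d a1 a2 a3 a4 (g : {ffun 'I_5 -> D}) : k := T g * (g == tup5 c a1 a2 a3 a4)%:R.
rewrite (eq_bigr (fun g => d u v w z g + d u v z w g + d v u w z g + d v u z w g
  + d w z u v g + d w z v u g + d z w u v g + d z w v u g)).
  rewrite !big_split /= !sum_delta.
  rewrite (T_swap12 c u v z w) (T_swap12 c u v w z) !(T_swap34 c u v w z).
  rewrite (T_swap12 c w z v u) (T_swap12 c w z u v) !(T_swap34 c w z u v).
  by rewrite (T_swap_pairs c u v w z); ring.
move=> g _; rewrite LE !pair_formE /d !tup5_eq -!mulnb !natrM; ring.
Qed.

Definition dg (h : {ffun 'I_5 -> D}) : nat := (\sum_i deg (e (h i)))%N.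

Lemma dgE h : dg h = (deg (e (h i0)) + (deg (e (h i1)) + deg (e (h i2)) +
  (deg (e (h i3)) + deg (e (h i4)))))%N.
Proof.
rewrite /dg !big_ord_recl big_ord0 addn0 !addnA.
by do 4?congr addn; congr (deg (e (h _))); apply: val_inj.
Qed.

Definition symmetric_sum (X : lmodType k) (beta : A -> A -> X) : X :=
  \sum_h T h *: app5 (commutator5 beta) ((b \o e) \o h).

(* Among the bad pairs (h, i), take one with dg h maximal and then with       *)
(* c = e (h i) of minimal degree. Comparing the coefficients of c (x) v with  *)
(* deg v >= dg h - deg c leaves only the terms c (x) (quadruple product), and *)
(* [sum_quad_functional] recovers T h from their sum.                         *)
Lemma top_support m (t : {malg k[(E * E)%type]}) :
    (forall u v, ~~ inB u -> t@_(u, v) = 0) ->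
    (forall u v, (m < deg u + deg v)%N -> t@_(u, v) = (symmetric_sum tens)@_(u, v)) ->
  forall h, T h != 0 -> (m < dg h)%N -> forall i, inB (e (h i)).
Proof.
move=> tB tE h0 Th0 mh0 j0; apply: contraT => nB0.
pose bad (q : {ffun 'I_5 -> D} * 'I_5) :=
  [&& T q.1 != 0, (m < dg q.1)%N & ~~ inB (e (q.1 q.2))].
have bad0 : bad (h0, j0) by rewrite /bad Th0 mh0.
have [q1 bad1 max1] := arg_maxnP (fun q : {ffun 'I_5 -> D} * 'I_5 => dg q.1) bad0.
pose bad' q := bad q && (dg q.1 == dg q1.1).
have bad1' : bad' q1 by rewrite /bad' bad1 eqxx.
have [q2 /andP[bad2 /eqP dg2] min2] :=
  arg_minnP (fun q : {ffun 'I_5 -> D} * 'I_5 => deg (e (q.1 q.2))) bad1'.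
have {bad1 bad1'} max (g : {ffun 'I_5 -> D}) i : T g != 0 -> (m < dg g)%N -> ~~ inB (e (g i)) ->
    (dg g <= dg q2.1)%N.
  by move=> Tg mg gB; rewrite dg2; apply: (max1 (g, i)); rewrite /bad Tg mg.
have {min2} min (g : {ffun 'I_5 -> D}) i : T g != 0 -> (m < dg g)%N -> ~~ inB (e (g i)) ->
    dg g = dg q2.1 -> (deg (e (q2.1 q2.2)) <= deg (e (g i)))%N.
  move=> Tg mg gB gq; apply: (min2 (g, i)).
  by rewrite /bad' /bad Tg mg gB /= gq dg2 eqxx.
case: q2 bad2 max min {dg2} => h i /= /and3P[/= Th mh hB] max min.
(* By symmetry of [T] the bad entry may be moved to the first position. *)
pose h' : {ffun 'I_5 -> D} := [ffun j => h (tperm i0 i j)].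
have h'0 : h' i0 = h i by rewrite ffunE tpermL.
have Th' : T h' = T h by exact: sym_swap.
have dgh' : dg h' = dg h.
  rewrite /dg [RHS](reindex (tperm i0 i)) /=; last first.
    by apply: onW_bij; exists (tperm i0 i) => j; exact: tpermK.
  by apply: eq_bigr => j _; rewrite ffunE.
rewrite -h'0 in hB min; rewrite -dgh' in max min mh; rewrite -Th' in Th.
move: h' {h'0 Th' dgh'} Th mh hB max min => {}h Th mh hB max min.
set c := h i0 in hB min.
pose p := (dg h - deg (e c))%N.
have pE : p = (deg (e (h i1)) + deg (e (h i2)) +
    (deg (e (h i3)) + deg (e (h i4))))%N by rewrite /p dgE addKn.
have dghE : dg h = (deg (e c) + p)%N by rewrite pE dgE.
pose Q (g : {ffun 'I_5 -> D}) :=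
  quad (b (e (g i1))) (b (e (g i2))) (b (e (g i3))) (b (e (g i4))).
have Qle (g : {ffun 'I_5 -> D}) : fle (deg (e (g i1)) + deg (e (g i2)) +
    (deg (e (g i3)) + deg (e (g i4)))) (Q g).
  by apply: fleM; apply: fleM; exact: fle_b.
(* [G] is the factor that accompanies c. It has no coordinate of degree p or more, although the four
   entries beside c in h have total degree exactly p; a functional of that degree then gives 8 times
   [T h] = 0. *)
pose G := \sum_g (T g * (g i0 == c)%:R) *: Q g.
have Gv v : (p <= deg v)%N -> (co G)@_v = 0.
  move=> pv; have := tE (e c) v.
  rewrite tB // => /(_ _)/esym; rewrite dghE in mh.
  rewrite (leq_trans mh) ?leq_add2l // => /(_ isT).
  rewrite /symmetric_sum raddf_sum => S0.
  rewrite /G (linear_sum co) raddf_sum -[RHS]S0; apply: eq_bigr => g _.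
  rewrite /= (linearZ_LR co) /= !mcoeffZ -mulrA; have [->|Tg] := eqVneq (T g) 0.
    by rewrite !mul0r.
  congr (_ * _); rewrite /app5 commutator5_coeff /= !co_bE.
  rewrite (inj_eq e_inj) -/(Q g); suff -> : (co (Q g))@_(e c) * (e (g i0) == v)%:R = 0.
    by rewrite subr0.
  have [gv|] := eqVneq (e (g i0)) v; last by rewrite mulr0.
  rewrite mulr1; apply/eqP/negPn/negP => Qc.
  have /fleP /(_ _ Qc) cle := Qle g.
  set s4 := (_ + _)%N in cle.
  have dgg : dg g = (deg v + s4)%N by rewrite -gv; exact: dgE.
  have mg : (m < dg g)%N.
    by rewrite dgg addnC; apply: leq_trans mh _; exact: leq_add.
  (* Suppose such an entry lies outside S. Maximality of [dg h] gives s4 <= deg c, while [cle] and p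
     <= deg v give [dg g] >= [dg h]. So g is also of top degree, and minimality of c gives deg c <=
     deg (g j) < s4 <= deg c. Hence all four factors lie in S, and their product cannot involve
     c. *)
  have notB (j : 'I_5) : (deg (e (g j)) < s4)%N -> inB (e (g j)).
    move=> jlt; apply/negPn/negP => gB; have le := max _ _ Tg mg gB.
    have s4c : (s4 <= deg (e c))%N.
      rewrite -(leq_add2l (deg v)) -dgg; apply: leq_trans le _.
      by rewrite dghE addnC leq_add2r.
    have := min _ _ Tg mg gB; rewrite leqNgt (leq_trans jlt s4c) => H.
    have // : false; apply: H; apply/eqP; rewrite eqn_leq le dghE dgg addnC.
    exact: leq_add.
  have [B1 B2 B3 B4] := lt_sum4 (deg_gt0 (e (g i1))) (deg_gt0 (e (g i2)))
    (deg_gt0 (e (g i3))) (deg_gt0 (e (g i4))).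
  move/negP: hB; apply; have : inS (Q g) by apply: inS_quad; apply: inS_b; exact: notB.
  by apply.
have p0 : (0 < p)%N by rewrite pE; have := deg_gt0 (e (h i1)); lia.
have Gle : fle p.-1 G.
  apply/fleP => v; apply: contraR; rewrite -ltnNge prednK // => pv.
  by rewrite Gv.
have [L [LE L0]] := quad_functional (e (h i1)) (e (h i2)) (e (h i3)) (e (h i4)).
have := sum_quad_functional c LE.
have -> : \sum_g T g * (g i0 == c)%:R * L (Q g) = L G.
  by rewrite linear_sum; apply: eq_bigr => g _; rewrite linearZ.
rewrite (L0 p.-1) // -?pE ?prednK // tup5K => /esym/eqP.
rewrite -mulr_natl mulf_eq0 (negPf Th) orbF.
by rewrite ((pcharf0P k).1 char0).
Qed.

End SymmetricTensor.

(** * Forms that are balanced on the subalgebra only *)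

Definition projB : {linear A -> A} :=
  (lin_ext (fun u => if inB u then b u else 0) \o co)%FUN.

Lemma projB_inS x : inS (projB x).
Proof.
rewrite /projB /= /lin_ext; elim/big_rec: _ => [|u y _ yS].
  by move=> u; rewrite linear0 mcoeff0 eqxx.
apply: inS_lin => //; case: ifP => [/inS_b//|_ v].
by rewrite linear0 mcoeff0 eqxx.
Qed.

Lemma projB_b u : inB u -> projB (b u) = b u.
Proof. by move=> uB; rewrite /projB /= co_b lin_extU uB. Qed.

(** Up to tensors of degree at most m, the tensor of [s] is a symmetric sum supported in S by
    [top_support]. The form kills that sum by polarisation, and it kills the remainder because this
    involves only pairs from S of degree at most m. *)
Lemma balanced_vanish (X : lmodType k) (beta : A -> A -> X) (m : nat)
    (s : seq (A * A)) :
    bilin beta -> (forall y, inS y -> balanced beta y) ->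
    (forall u v, inB u -> inB v -> (deg u + deg v <= m)%N ->
       beta (b u) (b v) = 0) ->
    (forall p, p \in s -> inS p.1 /\ inS p.2) ->
    fle m (\sum_(p <- s) p.1 ∙ p.2) ->
  \sum_(p <- s) beta p.1 p.2 = 0.
Proof.
move=> bl bal beta0 sS sm.
have [r rE] := relation_tensors sm.
have [D [e [T [e_inj Tsym TE]]]] := symmetric_tensor r.
set t := \sum_(p <- s) tens p.1 p.2 in rE.
have tB u v : ~~ (inB u && inB v) -> t@_(u, v) = 0.
  move=> nB; rewrite /t raddf_sum big_seq; apply: big1 => p /sS [p1 p2] /=.
  rewrite tens_coeff; have [->|/p1 uB] := eqVneq (co p.1)@_u 0.
    by rewrite mul0r.
  have [->|/p2 vB] := eqVneq (co p.2)@_v 0; first by rewrite mulr0.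
  by rewrite uB vB in nB.
have tE u v : (m < deg u + deg v)%N ->
    t@_(u, v) = (symmetric_sum e T tens)@_(u, v).
  by move=> uv; rewrite rE // (TE _ _ (commutator5_linear tens_bilin)).
have tB1 u v : ~~ inB u -> t@_(u, v) = 0.
  by move=> /negPf uB; rewrite tB // uB.
have top := top_support e_inj Tsym tB1 tE.
(* Only the part of degree above m is known to be supported in S. Dropping the rest keeps [T']
   symmetric and changes the tensor only in degrees at most m. *)
pose T' (h : {ffun 'I_5 -> D}) := T h * (m < dg e h)%N%:R.
have T'sym : symmetric5 T'.
  move=> h f fI; rewrite /T' Tsym //; congr (_ * (_ < _)%N%:R).
  have [f' fK f'K] := injF_bij fI.
  rewrite /dg (reindex f') /=; last by exists f => i _.
  by apply: eq_bigr => i _; rewrite ffunE f'K.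
have t'E u v : (m < deg u + deg v)%N ->
    (t - symmetric_sum e T' tens)@_(u, v) = 0.
  move=> uv; rewrite mcoeffB tE // /symmetric_sum -mcoeffB -sumrB raddf_sum.
  apply: big1 => h _ /=; rewrite -scalerBl mcoeffZ /T'.
  case: ltnP => hm; first by rewrite mulr1 subrr mul0r.
  rewrite mulr0 subr0 /app5 commutator5_coeff /=.
  have Qle : fle (dg e h - deg (e (h i0))) (quad (b (e (h i1))) (b (e (h i2)))
      (b (e (h i3))) (b (e (h i4)))).
    by rewrite dgE addKn; apply: fleM; apply: fleM; exact: fle_b.
  have /fleP hQ := Qle; have /fleP h0 := fle_b (e (h i0)).
  have le0 : (deg (e (h i0)) <= dg e h)%N by rewrite dgE leq_addr.
  set Q := quad _ _ _ _ in hQ *; set B := b (e (h i0)) in h0 *.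
  suff cross x y : (deg x + deg y > m)%N -> (co B)@_x * (co Q)@_y = 0.
    by rewrite cross // [X in _ - X]mulrC cross 1?addnC // subrr mulr0.
  move=> xy; have [->|/h0 hx] := eqVneq (co B)@_x 0; first by rewrite mul0r.
  have [->|/hQ hy] := eqVneq (co Q)@_y 0; first by rewrite mulr0.
  lia.
(* Polarisation needs an identity valid on all of A. Composing with the projection onto S provides
   one, and on the support of [T'] the projection is the identity. *)
pose P a1 a2 a3 a4 a5 := commutator5 beta (projB a1) (projB a2) (projB a3)
  (projB a4) (projB a5).
have Plin : linear5 P.
  have [l0 l1 l2 l3 l4] := commutator5_linear bl.
  have pl := linearP projB.
  by split=> x1 x2 x3 x4 c x y; rewrite /P pl ?l0 ?l1 ?l2 ?l3 ?l4.
have S0 : symmetric_sum e T' beta = 0.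
  have <- : \sum_h T' h *: app5 P ((b \o e) \o h) = symmetric_sum e T' beta.
    apply: eq_bigr => h _; rewrite /T'.
    have [->|Th] := eqVneq (T h) 0; first by rewrite mul0r !scale0r.
    case: ltnP => mh; last by rewrite mulr0 !scale0r.
    have hB := top _ Th mh.
    by rewrite /app5 /P; congr (_ *: commutator5 _ _ _ _ _ _); exact: projB_b.
  apply: sum_sym_eq0 => // y.
  by rewrite /P /commutator5 bal ?subrr //; exact: projB_inS.
have SB u v : ~~ (inB u && inB v) -> (symmetric_sum e T' tens)@_(u, v) = 0.
  move=> nB; rewrite /symmetric_sum raddf_sum; apply: big1 => h _ /=.
  rewrite mcoeffZ /T'; have [->|Th] := eqVneq (T h) 0; first by rewrite !mul0r.
  case: ltnP => mh; last by rewrite mulr0 mul0r.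
  have hB := top _ Th mh.
  rewrite /app5 commutator5_coeff /=.
  set Q := quad _ _ _ _; set B := b _.
  have QS : inS Q by apply: inS_quad; apply: inS_b.
  have BS : inS B by apply: inS_b.
  suff cross x y : ~~ (inB x && inB y) -> (co B)@_x * (co Q)@_y = 0.
    by rewrite cross // [X in _ - X]mulrC cross 1?andbC // subrr mulr0.
  move=> nxy; have [->|/BS xB] := eqVneq (co B)@_x 0; first by rewrite mul0r.
  have [->|/QS yB] := eqVneq (co Q)@_y 0; first by rewrite mulr0.
  by rewrite xB yB in nxy.
have Lt : tens_lift beta (t - symmetric_sum e T' tens) = 0.
  rewrite /tens_lift /= /lin_ext; apply: big1 => -[u v] _ /=.
  have [/andP[uB vB]|nB] := boolP (inB u && inB v); last first.
    by rewrite mcoeffB tB // SB // subrr scale0r.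
  case: (leqP (deg u + deg v) m) => uv; first by rewrite beta0 // scaler0.
  by rewrite t'E // scale0r.
move: Lt; rewrite linearB /= => /eqP; rewrite subr_eq0 => /eqP.
have -> : tens_lift beta (symmetric_sum e T' tens) = symmetric_sum e T' beta.
  rewrite /symmetric_sum linear_sum; apply: eq_bigr => h _.
  rewrite linearZ; congr (_ *: _); apply: etrans (linearB _ _ _) _.
  by congr (_ - _); exact: tens_liftE.
rewrite S0 => Lt; rewrite -[RHS]Lt /t raddf_sum; apply: eq_bigr => p _.
exact/esym/tens_liftE.
Qed.

End CoreLemma.

(** * The Nielsen-Schreier property *)

Lemma lspan_mono (k : fieldType) (V : lmodType k) (Q Q' : V -> Prop) x :
  (forall y, Q y -> Q' y) -> lspan Q x -> lspan Q' x.
Proof. by move=> QQ'; apply: lspan_trans => y /QQ'; exact: lspan_gen. Qed.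

Section BasisCoordinates.
Variables (k : fieldType) (V : lmodType k) (K : choiceType) (b : K -> V).
Hypothesis b_inj : injective (lin_ext b : {malg k[K]} -> V).
Hypothesis b_surj : forall x, exists g : {malg k[K]}, lin_ext b g = x.

Lemma basis_coordinates : exists co : {linear V -> {malg k[K]}},
  (forall x, lin_ext b (co x) = x) /\ forall g, co (lin_ext b g) = g.
Proof.
have [f fK] := choice b_surj.
have fl : linear f by move=> c x y; apply: b_inj; rewrite linearP /= !fK.
pose co : {linear V -> {malg k[K]}} :=
  HB.pack f (GRing.isLinear.Build k V {malg k[K]} *:%R f fl).
by exists co; split=> // g; apply: b_inj; exact: fK.
Qed.

End BasisCoordinates.

Section MalgSupport.
Variables (k : fieldType) (K : choiceType).

Definition malg_filter (P : pred K) : {linear {malg k[K]} -> {malg k[K]}} :=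
  lin_ext (fun u => if P u then << u >> else 0).

Lemma malg_filterE P g v : (malg_filter P g)@_v = if P v then g@_v else 0.
Proof.
rewrite /malg_filter /=; elim/malg_ind: g => [|u|c x y IHx IHy].
- by rewrite linear0 mcoeff0 if_same.
- rewrite lin_extU mcoeffU; have [<-|uv] := eqVneq u v.
    by case: ifP => _; rewrite ?mcoeff0 ?mcoeffU ?eqxx.
  by case: ifP => _; rewrite ?mcoeff0 ?mcoeffU ?(negPf uv) if_same.
- rewrite linearP !mcoeffD !mcoeffZ IHx IHy.
  by case: ifP => // _; rewrite mulr0 addr0.
Qed.

Lemma lin_ext_rpred (V : lmodType k) (S : subspace V) (b : K -> V)
    (g : {malg k[K]}) :
  (forall u, g@_u != 0 -> b u \in S) -> lin_ext b g \in S.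
Proof.
move=> gS; rewrite /lin_ext big_seq; apply: rpred_sum => u.
by rewrite -mcoeff_neq0 => /gS; exact: rpredZ.
Qed.

Lemma lin_ext_ind (V : lmodType k) (P : V -> Prop) (b : K -> V)
    (g : {malg k[K]}) :
    P 0 -> (forall c x y, P x -> P y -> P (c *: x + y)) ->
  (forall u, g@_u != 0 -> P (b u)) -> P (lin_ext b g).
Proof.
move=> P0 Plin gP; rewrite /lin_ext big_seq; elim/big_rec: _ => // u x.
by rewrite -mcoeff_neq0 => /gP Pu Px; exact: Plin.
Qed.

End MalgSupport.

(** * Generators of a subalgebra, chosen along the degree filtration *)

Section Subalgebra.
Variables (k : fieldType) (char0 : [pchar k] =i pred0).
Variables (Z : choiceType) (A : nalg k) (FP : presentation Z A).
Variable S : subalgebra A.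
Local Notation fle := (fle FP).
Local Notation B := (subalgebra_nalg S).

Lemma degree_ex x : exists m, `[< fle m x >].
Proof. by have [m mx] := fle_ex FP x; exists m; apply/asboolP. Qed.

Definition degree x := ex_minn (degree_ex x).

Lemma degreeP x : fle (degree x) x.
Proof. by rewrite /degree; case: ex_minnP => m /asboolP. Qed.

Lemma degree_le m x : fle m x -> (degree x <= m)%N.
Proof.
move=> mx; rewrite /degree; case: ex_minnP => n _; apply.
exact/asboolP.
Qed.

(** The bound is on the degrees of the factors, not on that of the sum, where leading terms might
    cancel. [prodS_sum] shows that such cancellation yields nothing new. *)
Definition prodS m : A -> Prop :=
  lspan (fun y => exists a b i j, [/\ a \in S, b \in S, fle i a, fle j b &
                     (i + j <= m)%N /\ y = a ∙ b]).

Lemma prodS_sub m x : prodS m x -> x \in S.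
Proof.
elim=> [|c y z [a [b [i [j [aS bS _ _ [_ ->]]]]]] _ zS]; first exact: rpred0.
by rewrite rpredD ?rpredZ // subalgebraM.
Qed.

(* Within each degree, a basis adapted to [rank] takes its elements first     *)
(* from the products of S, then from S, then from the rest.                   *)
Definition rank x := (3 * degree x +
  (if `[< prodS (degree x) x >] then 0 else if x \in S then 1 else 2))%N.

Lemma rank_degree x y : (rank x <= rank y)%N -> (degree x <= degree y)%N.
Proof. by rewrite /rank; do 4?case: ifP => _; lia. Qed.

Section Basis.
Variable E : {pred A}.
Local Notation K := {x : A | x \in E}.
Local Notation b := (fun u : K => val u).
Variable co : {linear A -> {malg k[K]}}.
Hypothesis coK : forall x, lin_ext b (co x) = x.
Hypothesis coE : forall g, co (lin_ext b g) = g.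
Hypothesis co_rank : forall x u, (co x)@_u != 0 -> (rank (val u) <= rank x)%N.

Definition deg (u : K) := degree (val u).
Definition inB : pred K := fun u => val u \in S.

Lemma co_b u : co (val u) = << u >>.
Proof. by rewrite -[RHS]coE lin_extU. Qed.

Lemma deg_gt0 u : (0 < deg u)%N.
Proof.
rewrite lt0n; apply/negP => /eqP u0; have := degreeP (val u).
rewrite -/(deg u) u0 => /fle0 v0; have := co_b u; rewrite v0 linear0.
move=> /(congr1 (fun g => g@_u)); rewrite mcoeff0 mcoeffU eqxx => /esym/eqP.
by rewrite (negPf (oner_neq0 k)).
Qed.

Lemma fleP m x : fle m x <-> forall u, (co x)@_u != 0 -> (deg u <= m)%N.
Proof.
split=> [xm u /co_rank /rank_degree ux|h].
  exact: leq_trans ux (degree_le xm).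
rewrite -(coK x); apply: (lin_ext_ind (P := fle m)).
- exact: lspan0.
- by move=> c u v; exact: lspan_lin.
- by move=> u /h um; apply: fle_mono um _; exact: degreeP.
Qed.

(** The basis elements lying in S span S. By the choice of [rank], the top-degree coordinates of an
    element of S belong to basis elements of S; subtract that part and induct on the degree. *)
Lemma inSP x : inS co inB x <-> x \in S.
Proof.
split=> [h|]; first by rewrite -(coK x); exact: lin_ext_rpred.
suff H n y : fle n y -> y \in S -> inS co inB y by exact: H (degreeP x).
elim: n y => [|n IH] {}x.
  by move=> /fle0 -> _ u; rewrite linear0 mcoeff0 eqxx.
move=> xn xS; have := degree_le xn; rewrite leq_eqVlt => /orP[/eqP d|dn]; last first.
  by apply: IH xS; apply: fle_mono (degreeP x).
pose y := lin_ext b (malg_filter k (fun u => deg u == n.+1) (co x)).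
have topS u : (co x)@_u != 0 -> deg u = n.+1 -> inB u.
  move=> /co_rank; rewrite /rank d xS -/(deg u) => ru du; rewrite du in ru.
  have [/asboolP /prodS_sub //|np] := boolP `[< prodS n.+1 (val u) >].
  apply/negPn/negP; rewrite /inB => /negPf uS; move: ru; rewrite (negPf np) uS.
  by case: ifP => _; lia.
have coy : co y = malg_filter k (fun u => deg u == n.+1) (co x) by rewrite coE.
have yS : y \in S.
  apply: lin_ext_rpred => u; rewrite malg_filterE; have [du xu|_] := eqVneq (deg u) n.+1.
    exact: topS.
  by rewrite eqxx.
have zS : x - y \in S by rewrite rpredB.
have zn : fle n (x - y).
  apply/fleP => u; rewrite linearB mcoeffB coy malg_filterE.
  have [_|du] := eqVneq (deg u) n.+1; first by rewrite subrr eqxx.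
  rewrite subr0 => xu; have /fleP /(_ _ xu) := xn.
  by rewrite leq_eqVlt (negPf du).
move=> u xu; have [du|du] := eqVneq (deg u) n.+1; first exact: topS.
apply: (IH _ zn zS u); rewrite linearB mcoeffB coy malg_filterE.
by rewrite (negPf du) subr0.
Qed.

Lemma inSM x y : inS co inB x -> inS co inB y -> inS co inB (x ∙ y).
Proof. by move=> /inSP xS /inSP yS; apply/inSP/subalgebraM. Qed.

Lemma form_vanish (X : lmodType k) (beta : A -> A -> X) (m : nat)
    (s : seq (A * A)) :
    bilin beta -> (forall y, y \in S -> balanced beta y) ->
    (forall x y i j, x \in S -> y \in S -> fle i x -> fle j y ->
       (i + j <= m)%N -> beta x y = 0) ->
    (forall p, p \in s -> p.1 \in S /\ p.2 \in S) ->
    fle m (\sum_(p <- s) p.1 ∙ p.2) ->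
  \sum_(p <- s) beta p.1 p.2 = 0.
Proof.
move=> bl bal beta0 sS.
apply: (balanced_vanish char0 coK co_b deg_gt0 fleP _ _ inSM bl).
- by move=> i j x y; exact: fle_mul.
- by move=> Y gamma; exact: balanced_form.
- by move=> y /inSP; exact: bal.
- move=> u v uB vB; apply: beta0 => //; exact: degreeP.
- by move=> p /sS [p1 p2]; split; apply/inSP.
Qed.

Lemma prodS_sum m (s : seq (A * A)) :
    (forall p, p \in s -> p.1 \in S /\ p.2 \in S) ->
    fle m (\sum_(p <- s) p.1 ∙ p.2) ->
  prodS m (\sum_(p <- s) p.1 ∙ p.2).
Proof.
move=> sS sm; have [X [q q0]] := @quotient_by k A (prodS m) (lspan0 _) (@lspan_lin k A _).
apply/q0; rewrite linear_sum.
apply: (form_vanish (beta := fun x y => q (x ∙ y))) sS sm.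
- by split=> y c u v; rewrite ?nalg_mul_linearl ?nalg_mul_linearr linearP.
- by move=> y _; rewrite /balanced (pres_in_M FP).
- move=> x y i j xS yS xi yj ij; apply/q0/lspan_gen.
  by exists x, y, i, j; split.
Qed.

(** The free generators of S: basis elements in the middle class of [rank]. *)
Definition Wpred : pred A := fun x => [&& x \in E, x \in S & ~~ `[< prodS (degree x) x >]].
Local Notation W := {x : A | Wpred x}.

Lemma W_E (w : W) : val w \in E. Proof. by case/and3P: (valP w). Qed.
Lemma W_S (w : W) : val w \in S. Proof. by case/and3P: (valP w). Qed.

Definition W_basis (w : W) : K := exist _ (val w) (W_E w).

Lemma W_basis_inj : injective W_basis.
Proof. by move=> w w' /(congr1 val) /= ww'; apply: val_inj. Qed.

(** By [prodS_sum] such an x has the lowest class of [rank] in its degree, so no element of W of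
    that degree occurs in it. All its coordinates then have smaller degree, which contradicts the
    definition of the degree unless there are none. *)
Lemma W_independent (g : {malg k[W]}) (s : seq (A * A)) :
    (forall p, p \in s -> p.1 \in S /\ p.2 \in S) ->
    lin_ext (fun w : W => val w) g = \sum_(p <- s) p.1 ∙ p.2 ->
  g = 0.
Proof.
set x := lin_ext _ g => sS xs.
have xP : prodS (degree x) x by rewrite {2}xs; apply: prodS_sum => //; rewrite -xs; exact: degreeP.
have cox : co x = lin_ext (fun w => << W_basis w >>) g.
  rewrite /x; elim/malg_ind: (g) => [|w|c u v IHu IHv].
  - by rewrite !linear0.
  - by rewrite !lin_extU -co_b.
  - by rewrite !linearP /= IHu IHv.
have coxW u : (co x)@_u != 0 -> Wpred (val u).
  rewrite cox; move: u.
  apply: (lin_ext_ind (P := fun h : {malg k[K]} => forall u, h@_u != 0 -> Wpred (val u))).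
  - by move=> u; rewrite mcoeff0 eqxx.
  - move=> c h h' hW h'W u; rewrite mcoeffD mcoeffZ.
    by have [->|/hW//] := eqVneq h@_u 0; rewrite mulr0 add0r => /h'W.
  - move=> w _ u; rewrite mcoeffU; case: (W_basis w =P u) => [<- _|].
      exact: valP w.
    by rewrite eqxx.
have degx u : (co x)@_u != 0 -> (deg u < degree x)%N.
  move=> ux; have := co_rank ux; have /and3P[_ uS uP] := coxW u ux.
  by rewrite /rank (negPf uP) uS asboolT // addn0 addn1 ltn_pmul2l.
have x0 u : (co x)@_u = 0.
  apply/eqP/negPn/negP => ux; have dx := degx u ux.
  have : fle (degree x).-1 x by apply/fleP => v /degx vx; rewrite -ltnS (ltn_predK dx).
  by move/degree_le; rewrite -ltnS (ltn_predK dx) ltnn.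
apply/malgP => w; rewrite mcoeff0 -[RHS](x0 (W_basis w)) cox.
elim/malg_ind: (g) => [|w'|c u v IHu IHv].
- by rewrite linear0 !mcoeff0.
- by rewrite lin_extU !mcoeffU (inj_eq W_basis_inj).
- by rewrite linearP !mcoeffD !mcoeffZ IHu IHv.
Qed.

(** * The subalgebra is free on the chosen generators *)

Section Generators.
Variables (F : nalg k) (PW : presentation W F).

Definition W_gen (w : W) : B := exist _ (val w) (W_S w).

Lemma B_in_M : in_M B.
Proof. by move=> x; apply: val_inj => /=; exact: pres_in_M FP _. Qed.

Variable theta : nalg_hom F B.
Hypothesis thetaE : forall p, theta (pres PW p) = ext PW (magma_eval W_gen) p.

Definition theta_val (y : F) : A := val (theta y).

Lemma theta_val_linear : linear theta_val.
Proof. by move=> c x y; rewrite /theta_val linearP. Qed.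

HB.instance Definition _ :=
  GRing.isLinear.Build k F A *:%R theta_val theta_val_linear.

Lemma theta_valM x y : theta_val (x ∙ y) = theta_val x ∙ theta_val y.
Proof. by rewrite /theta_val nalg_homM. Qed.

Lemma theta_valS x : theta_val x \in S.
Proof. exact: valP (theta x). Qed.

Definition gen (w : W) : F := pres PW (mono PW (Gen w)).

Lemma theta_val_gen w : theta_val (gen w) = val w.
Proof. by rewrite /theta_val /gen thetaE ext_mono. Qed.

Definition im (x : A) : Prop := exists y, theta_val y = x.

Lemma im0 : im 0.
Proof. by exists 0; rewrite linear0. Qed.

Lemma im_lin c x y : im x -> im y -> im (c *: x + y).
Proof. by move=> [u <-] [v <-]; exists (c *: u + v); rewrite linearP. Qed.

(** Induction on the degree: a basis element of S is a generator or a sum of products whose non-zero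
    factors have smaller degree. *)
Lemma theta_surj x : x \in S -> im x.
Proof.
suff H n y : fle n y -> y \in S -> im y by exact: H (degreeP x).
elim: n y => [|n IH] {}x; first by move=> /fle0 -> _; exact: im0.
move=> /fleP xn /inSP xS; rewrite -(coK x); apply: lin_ext_ind.
- exact: im0.
- exact: im_lin.
- move=> u xu; have uS : val u \in S := xS _ xu.
  have un := xn _ xu.
  have [/asboolP uP|uP] := boolP `[< prodS (degree (val u)) (val u) >]; last first.
    have uW : Wpred (val u) by apply/and3P; split=> //; exact: valP u.
    by exists (gen (exist _ (val u) uW)); rewrite theta_val_gen.
  elim: uP => [|c _ y [a [a' [i [j [aS a'S ai a'j [ij ->]]]]]] _ yi]; first exact: im0.
  apply: im_lin => //; have AB := nalg_mul_bilin A.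
  have [i0|i0] := posnP i.
    by rewrite i0 in ai; rewrite (fle0 ai) (bilin0l AB); exact: im0.
  have [j0|j0] := posnP j.
    by rewrite j0 in a'j; rewrite (fle0 a'j) (bilin0r AB); exact: im0.
  have ijn : (i + j <= n.+1)%N := leq_trans ij un.
  have [|//|v <-] := IH a; first by apply: fle_mono ai; lia.
  have [|//|v' <-] := IH a'; first by apply: fle_mono a'j; lia.
  by exists (v ∙ v'); rewrite theta_valM.
Qed.

Lemma section_ex :
  exists s : {linear A -> F}, forall x, x \in S -> theta_val (s x) = x.
Proof.
have /choice [c cP] : forall u : K, exists y, inB u -> theta_val y = val u.
  move=> u; have [/theta_surj [y yu]|nu] := boolP (inB u); first by exists y.
  by exists 0.
exists (lin_ext c \o co)%FUN => x /inSP xS /=.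
rewrite -[RHS](coK x) /lin_ext linear_sum big_seq [RHS]big_seq.
apply: eq_bigr => u; rewrite -mcoeff_neq0 => /xS uB.
by rewrite linearZ /= cP.
Qed.

Lemma decomposition (x : F) : exists (g : {malg k[W]}) (s : seq (F * F)),
  x = lin_ext gen g + \sum_(p <- s) p.1 ∙ p.2.
Proof.
have [p <-] := pres_surj PW x.
elim/(@cover_ind _ _ _ PW): p => [|[w|a a']|c u v [g [s us]] [h [t vt]]].
- by exists 0, [::]; rewrite big_nil !linear0 addr0.
- by exists << w >>, [::]; rewrite big_nil addr0 lin_extU.
- exists 0, [:: (pres PW (mono PW a), pres PW (mono PW a'))].
  by rewrite big_seq1 linear0 add0r monoM nalg_homM.
- exists (c *: g + h), ([seq (c *: p.1, p.2) | p <- s] ++ t).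
  rewrite !linearP us vt big_cat big_map scalerDr addrACA; congr (_ + (_ + _)).
  rewrite scaler_sumr; apply: eq_bigr => p _ /=.
  by rewrite (bilinZl (nalg_mul_bilin F)).
Qed.

Lemma theta_inj x : theta_val x = 0 -> x = 0.
Proof.
have FB := nalg_mul_bilin F.
(* The kernel is shown to lie in every power of the augmentation ideal. *)
suff H n y : theta_val y = 0 -> fge PW n.+1 y.
  move=> x0; apply: (fge_residual (FP := PW)) => // -[|n]; last exact: H.
  by apply: lspan_mono (H 0%N _ x0) => _ [t <- _]; exists t.
elim: n y => [|n IH] {}x x0; first exact: fge1.
have [X [q q0]] := @quotient_by k F (fge PW n.+2) (lspan0 _) (@lspan_lin k F _).
have [s sK] := section_ex.
have kerl u v : theta_val u = 0 -> q (u ∙ v) = 0.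
  by move=> /IH u0; apply/q0; rewrite -[n.+2]addn1; apply: fge_mul u0 (fge1 _ _).
have kerr u v : theta_val u = 0 -> q (v ∙ u) = 0.
  by move=> /IH u0; apply/q0; rewrite -[n.+2]add1n; apply: fge_mul (fge1 _ _) u0.
have qM u u' v v' : theta_val u = theta_val u' -> theta_val v = theta_val v' ->
    q (u ∙ v) = q (u' ∙ v').
  move=> uu vv; apply/eqP; rewrite -subr_eq0 -linearB.
  have -> : u ∙ v - u' ∙ v' = (u - u') ∙ v + u' ∙ (v - v').
    by rewrite (bilinBl FB) (bilinBr FB) addrA subrK.
  rewrite linearD kerl ?kerr ?addr0 //; first by rewrite linearB /= vv subrr.
  by rewrite linearB /= uu subrr.
(* By the induction hypothesis, a kernel element times anything dies under [q], so modulo the next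
   power the choice of the section is irrelevant and the identity in the free algebra makes [beta]
   balanced on S. *)
pose beta y z := q (s y ∙ s z).
have bl : bilin beta.
  by split=> y c u v; rewrite /beta linearP ?nalg_mul_linearl ?nalg_mul_linearr linearP.
have bal y : y \in S -> balanced beta y.
  move=> yS; rewrite /balanced /beta.
  have quadE : theta_val (s (quad y y y y)) = theta_val (quad (s y) (s y) (s y) (s y)).
    by rewrite sK /quad ?theta_valM ?sK // !subalgebraM.
  rewrite (qM _ (s y) _ _ erefl quadE) [RHS](qM _ _ _ (s y) quadE erefl).
  by rewrite (pres_in_M PW).
have [g [r xE]] := decomposition x.
have xE' : lin_ext (fun w : W => val w) g
    = \sum_(p <- [seq (- theta_val p.1, theta_val p.2) | p <- r]) p.1 ∙ p.2.
  move: x0; rewrite xE linearD /= /lin_ext !linear_sum big_map /= => /eqP.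
  rewrite addr_eq0 => /eqP E1.
  transitivity (\sum_(w <- msupp g) theta_val (g@_w *: gen w)).
    by apply: eq_bigr => w _; rewrite linearZ /= theta_val_gen.
  rewrite E1 -sumrN; apply: eq_bigr => p _.
  by rewrite -scaleN1r (bilinZl (nalg_mul_bilin A)) scaleN1r theta_valM.
have g0 : g = 0.
  apply: W_independent xE' => _ /mapP [p _ ->] /=.
  by rewrite rpredN !theta_valS.
apply/q0; rewrite xE g0 linear0 add0r linear_sum.
have S0 : \sum_(p <- [seq (theta_val p.1, theta_val p.2) | p <- r])
    beta p.1 p.2 = 0.
  (* The relation is an exact zero, so the bound 0 suffices: only the zero vector has degree 0. *)
  apply: (form_vanish (m := 0) bl bal).
  - move=> y z i j _ _ yi _; rewrite leqn0 addn_eq0 => /andP[/eqP i0 _].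
    by rewrite i0 in yi; rewrite (fle0 yi) (bilin0l bl).
  - by move=> _ /mapP [p _ ->]; rewrite !theta_valS.
  - suff -> : \sum_(p <- [seq (theta_val p.1, theta_val p.2) | p <- r])
        p.1 ∙ p.2 = 0 by exact: lspan0.
    rewrite big_map -[RHS]x0 xE g0 linear0 add0r linear_sum; apply: eq_bigr => p _.
    exact/esym/theta_valM.
rewrite -[RHS]S0 big_map; apply: eq_bigr => p _; rewrite /beta /=.
by apply: qM; rewrite sK ?theta_valS.
Qed.

Lemma theta_bij : bijective theta.
Proof.
have surj y : exists x, theta x = y.
  by have [x xy] := theta_surj (valP y); exists x; exact: val_inj.
have inj : injective theta.
  move=> x y xy; apply/eqP; rewrite -subr_eq0; apply/eqP/theta_inj.
  by rewrite /theta_val linearB /= xy subrr.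
have [g gK] := choice surj.
by exists g => // x; apply: inj.
Qed.

End Generators.

Lemma basis_free : is_free B.
Proof.
exists {x : A | Wpred x}.
have [theta thetaE] := pres_eval (free_presentation k _) B_in_M W_gen.
have [f [tf ft]] := nalg_hom_inv (theta_bij thetaE).
by exists f; exists theta.
Qed.

End Basis.

Lemma subalgebra_free : is_free B.
Proof.
have [E [inj ex]] := adapted_basis rank.
have [co [coK coE]] : exists co : {linear A -> {malg k[{x | x \in E}]}},
    (forall x, lin_ext (fun u : {x | x \in E} => val u) (co x) = x) /\
    forall g, co (lin_ext (fun u : {x | x \in E} => val u) g) = g.
  by apply: basis_coordinates => // x; have [g [gx _]] := ex x; exists g.
apply: (basis_free coK coE) => x u; have [g [gx gr]] := ex x.
by rewrite -gx coE mcoeff_neq0 gx; exact: gr.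
Qed.

End Subalgebra.

Lemma Nielsen_Schreier_char0 (k : fieldType) :
  [pchar k] =i pred0 -> Nielsen_Schreier k.
Proof.
move=> char0 A /is_free_presentation [Z [FP]] S.
exact (subalgebra_free char0 FP S).
Qed.

(** * Failure of the Poincare-Birkhoff-Witt property *)

Lemma linear_ext (k : fieldType) (U V : lmodType k) (f g : {linear U -> V}) :
  f =1 g -> f = g.
Proof.
case: f => f [[f1] [f2]]; case: g => g [[g1] [g2]] /= /funext fg.
move: f1 f2 g1 g2; rewrite fg => f1 f2 g1 g2.
by rewrite (Prop_irrelevance f1 g1) (Prop_irrelevance f2 g2).
Qed.

Section ZeroProductLine.
Variable k : fieldType.

Definition line_mul (x y : k^o) : k^o := 0.

Lemma line_mul_linearl y : linear (line_mul^~ y).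
Proof. by move=> c u v; rewrite /line_mul scaler0 addr0. Qed.

Lemma line_mul_linearr x : linear (line_mul x).
Proof. by move=> c u v; rewrite /line_mul scaler0 addr0. Qed.

Lemma line_in_M : in_M (NAlg line_mul_linearl line_mul_linearr).
Proof. by []. Qed.

Definition line : M_alg k := MAlg line_in_M.

Definition plane_mul (x y : (k^o * k^o)%type) : (k^o * k^o)%type := (0, x.1 * y.1).

Lemma plane_mul_linearl y : linear (plane_mul^~ y).
Proof.
by move=> c u v; congr (_, _); rewrite /= ?scaler0 ?addr0 // mulrDl scalerAl.
Qed.

Lemma plane_mul_linearr x : linear (plane_mul x).
Proof.
by move=> c u v; congr (_, _); rewrite /= ?scaler0 ?addr0 // mulrDr scalerAr.
Qed.

Lemma plane_in_M : in_M (NAlg plane_mul_linearl plane_mul_linearr).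
Proof. by move=> x; congr (_, _); rewrite /= !mulr0 mul0r. Qed.

Definition plane : M_alg k := MAlg plane_in_M.

Definition plane_x : plane := ((1, 0) : k^o * k^o).
Definition plane_y : plane := ((0, 1) : k^o * k^o).

Definition line_incl (c : line) : plane := ((0, c) : k^o * k^o).

Lemma line_incl_linear : linear line_incl.
Proof. by move=> c u v; congr (_, _); rewrite /= scaler0 addr0. Qed.

HB.instance Definition _ :=
  GRing.isLinear.Build k line plane *:%R line_incl line_incl_linear.

Lemma line_inclM : {morph line_incl : x y / x ∙ y}.
Proof. by move=> x y; congr (_, _); rewrite /= mul0r. Qed.

Definition line_incl_hom : nalg_hom line plane := NAlgHom line_inclM.

Definition plane_proj (u : plane) : line := u.2.

Lemma plane_proj_linear : linear plane_proj.
Proof. by []. Qed.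

HB.instance Definition _ :=
  GRing.isLinear.Build k plane line *:%R plane_proj plane_proj_linear.

(** * The bimodule relation, and its consequence over the plane *)

Section Operators.
Variables (A : M_alg k) (V : bimodule A).

Lemma lact0l (v : V) : lact 0 v = 0.
Proof. by have := lact_linearl v (-1) 0 0; rewrite !scaleN1r oppr0 addr0 addNr. Qed.

Lemma ract0r (v : V) : ract v 0 = 0.
Proof. by have := ract_linearr v (-1) 0 0; rewrite !scaleN1r oppr0 addr0 addNr. Qed.

Definition op_s (a : A) (v : V) : V := lact a v + ract v a.
Definition op_d (a : A) (v : V) : V := lact a v - ract v a.

Lemma bimodule_relation (a : A) (v : V) :
  (a ∙ a) ∙ (a ∙ a) = 0 -> op_d a (op_s (a ∙ a) (op_s a v)) = 0.
Proof.
move=> a0; have := bimodP (a, v) => /(congr1 snd) /=.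
rewrite -/(op_s a v) -/(op_s (a ∙ a) (op_s a v)) a0 lact0l ract0r addr0 add0r.
by rewrite /op_d => ->; rewrite subrr.
Qed.

Lemma op_s_linear v : linear (op_s^~ v).
Proof.
by move=> c a b; rewrite /op_s lact_linearl ract_linearr scalerDr addrACA.
Qed.

Lemma op_s_linearr a : linear (op_s a).
Proof.
by move=> c u v; rewrite /op_s lact_linearr ract_linearl scalerDr addrACA.
Qed.

Lemma op_d_linear v : linear (op_d^~ v).
Proof.
move=> c a b; rewrite /op_d lact_linearl ract_linearr scalerBr.
by rewrite opprD addrACA.
Qed.

Lemma op_d_linearr a : linear (op_d a).
Proof.
move=> c u v; rewrite /op_d lact_linearr ract_linearl scalerBr.
by rewrite opprD addrACA.
Qed.

End Operators.

(** Every a = t y + x has square y, and y y = 0, so d_a s_y s_a = 0 for all t. This is a quadratic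
    polynomial in t; its values at 0, 1 and -1 give twice the leading coefficient d_y s_y s_y. *)
Lemma plane_relation (V : bimodule plane) (v : V) :
    [pchar k] =i pred0 ->
  op_d plane_y (op_s plane_y (op_s plane_y v)) = 0.
Proof.
move=> char0.
pose D a c := op_d a (op_s plane_y (op_s c v)).
have Dl : forall c, linear (D^~ c) by move=> c t a a'; exact: op_d_linear.
have Dr : forall a, linear (D a).
  by move=> a t c c'; rewrite /D op_s_linear op_s_linearr op_d_linearr.
have D0 t : D (t *: plane_y + plane_x) (t *: plane_y + plane_x) = 0.
  set a := t *: plane_y + plane_x.
  have sq : a ∙ a = plane_y.
    by congr (_, _); rewrite /= scaler0 add0r mulr1.
  rewrite /D -sq; apply: bimodule_relation; rewrite sq.
  by congr (_, _); rewrite /= mulr0.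
have E t : t *: (t *: D plane_y plane_y + D plane_y plane_x)
    + (t *: D plane_x plane_y + D plane_x plane_x) = 0.
  by rewrite -[RHS](D0 t) Dl !Dr.
have := E 0; rewrite !scale0r !add0r => xx.
have := E 1; have := E (-1); rewrite xx !scale1r !scaleN1r !addr0.
rewrite opprD opprK -addrA -opprD => /eqP; rewrite subr_eq0 => /eqP yy.
rewrite -addrA -yy => /eqP; rewrite -mulr2n -scaler_nat scaler_eq0.
by rewrite ((pcharf0P k).1 char0) => /eqP.
Qed.

Definition line_e : line := (1 : k^o).
Definition line_lact (a v : k^o) : k^o := a * v.
Definition line_ract (v a : k^o) : k^o := 0.

Lemma line_lact_linearl v : linear (line_lact^~ v).
Proof. by move=> c a b; rewrite /line_lact mulrDl scalerAl. Qed.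
Lemma line_lact_linearr a : linear (line_lact a).
Proof. by move=> c u v; rewrite /line_lact mulrDr scalerAr. Qed.
Lemma line_ract_linearl a : linear (line_ract^~ a).
Proof. by move=> c u v; rewrite /line_ract scaler0 addr0. Qed.
Lemma line_ract_linearr v : linear (line_ract v).
Proof. by move=> c a b; rewrite /line_ract scaler0 addr0. Qed.

Lemma line_bimodP : in_M (split_null_ext (A := line) line_lact_linearl
  line_lact_linearr line_ract_linearl line_ract_linearr).
Proof.
move=> [a v]; congr (_, _) => /=.
by rewrite /line_lact /line_ract /line_mul !mul0r !addr0 mulr0.
Qed.

Definition line_bimodule : bimodule line := Bimodule line_bimodP.

Local Notation op_alg := {malg k[{fmonom (line + line)%type}]}.

Definition line_l : op_alg := << fmu (inl line_e) >>.
Definition line_r : op_alg := << fmu (inr line_e) >>.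
Definition line_op : op_alg :=
  (line_l - line_r) * ((line_l + line_r) * (line_l + line_r)).

Lemma act_line_op (V : bimodule line) (v : V) :
  act line_op v = op_d line_e (op_s line_e (op_s line_e v)).
Proof.
have lE (w : V) : act line_l w = lact line_e w.
  by rewrite actU /act_word fmU.
have rE (w : V) : act line_r w = ract w line_e.
  by rewrite actU /act_word fmU.
have sE (w : V) : act (line_l + line_r) w = op_s line_e w.
  have := act_linearl w 1 line_l line_r; rewrite !scale1r => ->.
  by rewrite lE rE.
rewrite /line_op !actM !sE; set w := op_s _ (op_s _ _).
rewrite -[line_l - _]addrC -scaleN1r act_linearl scaleN1r lE rE.
by rewrite addrC.
Qed.

Lemma not_PBW : [pchar k] =i pred0 -> ~ PBW_property k.
Proof.
move=> char0 [X [eta [eta_bij eta_nat]]].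
pose u := env_proj line line_op.
have u0 : env_map line_incl_hom u = 0.
  rewrite /u env_mapE -[RHS](linear0 (env_proj plane)); apply/env_projP => V v.
  rewrite act_op_map act_line_op act0l; exact: plane_relation.
have : u = 0.
  apply: (bij_inj (eta_bij line)); rewrite linear0.
  (* The retraction [plane_proj] is linear but not a homomorphism; this is where the functor being
     defined on vector spaces is used. *)
  have gf : vfun_map X plane_proj (vfun_map X line_incl_hom (eta line u))
      = eta line u.
    rewrite -[RHS](@vfun_id k X line) -[LHS]vfun_comp.
    by congr (vfun_map X _ _); exact: linear_ext.
  by rewrite -gf -eta_nat u0 !linear0.
rewrite /u -(linear0 (env_proj line)) => /env_projP.
move=> /(_ line_bimodule 1); rewrite act_line_op act0l /op_d /op_s /=.
rewrite /line_lact /line_ract /= !addr0 subr0 !mul1r => /eqP.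
by rewrite (negPf (oner_neq0 k)).
Qed.

End ZeroProductLine.

Theorem theorem2p1 (k : fieldType) (char0 : [pchar k] =i pred0) :
  Nielsen_Schreier k /\ ~ PBW_property k.
Proof. by split; [exact: Nielsen_Schreier_char0 | exact: not_PBW]. Qed.
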